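(* Let $K \in \mathbb{R}^{n \times n}$ be a rate constant matrix with stationary distribution $\pi \in \Delta_n^\circ$. Let $\{u_1, \dotsc, u_n\}$ be an eigenbasis of $K$ that is orthonormal with respect to $\langle\cdot,\cdot\rangle_\pi$, with corresponding eigenvalues $\lambda_1, \dotsc, \lambda_n$. Let $\{S, T\}$ be a bipartition of $[n]$ with $K_{SS}$ nonsingular, let $D := K_{TT} - K_{TS}K_{SS}^{-1}K_{ST}$ be the Schur complement of $K_{SS}$ in $K$, and let $V \in \mathbb{R}^{n \times n}$ be the matrix of Type A or of Type B associated with $(K, S, T)$. For every real $t \ge 0$, $$\mathrm{Err}_{S,t}(p) \le \min\left\{\sum_{k=1}^n \frac{|\langle u_k, p\rangle_\pi|}{\|p\|_\pi} \min\{1, \alpha_k, \beta_k\},\ 1\right\} \quad \text{for all } p \in \Delta_n,$$ and $$\mathbb{E}_p[\mathrm{Err}_{S,t}(p)] \le \min\left\{\sqrt{\frac1n \sum_{k=1}^n \min\{1, \alpha_k, \beta_k\}^2},\ 1\right\},$$ where in the second bound $p$ is drawn uniformly at random from the standard basis vectors $e_1,\dotsc,e_n$, and for $k \in [n]$ $$\alpha_k := \frac{\rho(D)}{|\lambda_k|} + e^{t\lambda_k},$$ $$\beta_k := \frac{|\lambda_k| + \sqrt{2\,\|\Pi^{-1}K\|_{\infty,\mathrm{off}}\,|\lambda_k|}}{\sigma(K_{SS})} + 1 - e^{t\lambda_k} \ \text{ (Type A)}, \qquad \beta_k := \frac{|\lambda_k|}{\sigma(K_{SS})} + 1 - e^{t\lambda_k}\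 \text{ (Type B)},$$ with the convention $\alpha_k := +\infty$ if $\lambda_k = 0$.
   Context: $[n] = \{1,\dotsc,n\}$. $\Delta_n = \{y \in \mathbb{R}_{\ge 0}^n : \sum_i y_i = 1\}$ and $\Delta_n^\circ = \{y \in \mathbb{R}_{>0}^n : \sum_i y_i = 1\}$. A rate constant matrix with stationary distribution $\pi \in \Delta_n^\circ$ is a matrix $K \in \mathbb{R}^{n\times n}$ such that $K_{ij} \ge 0$ for $i \ne j$, every column of $K$ sums to $0$, and $K_{ij}\pi_j = K_{ji}\pi_i$ for all $i,j$. $\Pi = \mathrm{diag}(\pi)$. The $\pi$-inner product on $\mathbb{R}^n$ is $\langle a, b\rangle_\pi = a^\top \Pi^{-1} b$, with norm $\|a\|_\pi = \sqrt{\langle a,a\rangle_\pi}$. Such a $K$ is self-adjoint for the $\pi$-inner product and has real, non-positive eigenvalues. A bipartition $\{S,T\}$ of $[n]$ is a pair of disjoint nonempty sets with $S \cup T = [n]$; $A_{IJ}$ denotes the submatrix of $A$ with rows $I$ and columns $J$, $K_{SS}^{-1} = (K_{SS})^{-1}$, and $K_{SS}^{-2} = (K_{SS}^{-1})^2$. Let $M := I_T + K_{TS}K_{SS}^{-2}K_{ST} \in \mathbb{R}^{T\times T}$ and let $\mathbf{1}_T$ be the all-one vector in $\mathbb{R}^T$. The matrix $V$ associated with $(K,S,T)$ is, with blocks ordered $S,T$, $$V = \begin{pmatrix} K_{SS}^{-1} K_{ST} V_{TT} K_{TS} K_{SS}^{-1} & -K_{SS}^{-1} K_{ST} V_{TT}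 \\ -V_{TT} K_{TS} K_{SS}^{-1} & V_{TT} \end{pmatrix},$$ where $V_{TT} = \mathrm{diag}(\mathbf{1}_T^\top M)^{-1}$ for Type A and $V_{TT} = M^{-1}$ for Type B ($\mathrm{diag}(y)$ is the diagonal matrix with the components of $y$ on the diagonal). For $q \in \mathbb{R}^n$, $\mathrm{proj}(q) := \operatorname{argmin}\{\|q' - q\|_\pi : q' \in \Delta_n\}$. For $t \ge 0$ and $p \in \Delta_n$, $$\mathrm{Err}_{S,t}(p) := \frac{\|\mathrm{proj}(Vp) - e^{tK}p\|_\pi}{\|p\|_\pi}.$$ For a square matrix $A$, $\rho(A)$ and $\sigma(A)$ denote the maximum and minimum absolute value of an eigenvalue of $A$, and $\|A\|_{\infty,\mathrm{off}}$ denotes the maximum absolute value of an off-diagonal entry of $A$. *)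

(* Defs.v *)
From mathcomp Require Import all_boot all_order all_algebra.
From mathcomp Require Import boolp classical_sets reals constructive_ereal.
From mathcomp Require Import topology normedtype sequences exp.
From mathcomp.real_closed Require Import complex.
Set Implicit Arguments.
Unset Strict Implicit.
Unset Printing Implicit Defensive.
Import Order.TTheory GRing.Theory Num.Theory.
Import numFieldNormedType.Exports.

Local Open Scope classical_set_scope.
Local Open Scope ring_scope.

Section Defs.
Variables (R : realType) (n : nat).
Implicit Types (K A : 'M[R]_n) (pi p q a b : 'cV[R]_n) (I J S T : {set 'I_n}).

Definition simplex : set 'cV[R]_n :=
  [set y : 'cV[R]_n | (forall i, 0 <= y i 0) /\ \sum_i y i 0 = 1].

Definition open_simplex : set 'cV[R]_n :=
  [set y : 'cV[R]_n | (forall i, 0 < y i 0) /\ \sum_i y i 0 = 1].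

Definition rate_constant_matrix K pi : Prop :=
  [/\ open_simplex pi,
      forall i j, i != j -> 0 <= K i j,
      forall j, \sum_i K i j = 0
    & forall i j, K i j * pi j 0 = K j i * pi i 0].

Definition Pimx pi : 'M[R]_n := diag_mx pi^T.

Definition dotpi pi a b : R := (a^T *m invmx (Pimx pi) *m b) 0 0.

Definition normpi pi a : R := Num.sqrt (dotpi pi a a).

Definition orthonormal_eigenbasis K pi (u : 'I_n -> 'cV[R]_n) (lam : 'I_n -> R)
    : Prop :=
  [/\ basis_of fullv [seq u k | k <- enum 'I_n],
      forall i j, dotpi pi (u i) (u j) = (i == j)%:R
    & forall k, K *m u k = lam k *: u k].

Definition bipartition S T : Prop :=
  [/\ S != finset.set0, T != finset.set0,
      S :&: T = finset.set0 & S :|: T = [set: 'I_n]%SET].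

(* A_{IJ}, with the elements of I and J listed in increasing order. *)
Definition blk A I J : 'M[R]_(#|I|, #|J|) := mxsub enum_val enum_val A.

(* Inverse operation: the n x n matrix with block B at rows I and columns J,
   and zeros elsewhere. *)
Definition sel I : 'M[R]_(#|I|, n) := rowsub enum_val 1%:M.
Definition place I J (B : 'M[R]_(#|I|, #|J|)) : 'M[R]_n :=
  (sel I)^T *m B *m sel J.

Definition schur K S T : 'M[R]_#|T| :=
  blk K T T - blk K T S *m invmx (blk K S S) *m blk K S T.

Definition Mmx K S T : 'M[R]_#|T| :=
  1%:M + blk K T S *m (invmx (blk K S S) *m invmx (blk K S S)) *m blk K S T.

Inductive vtype := TypeA | TypeB.

Definition VTT (ty : vtype) K S T : 'M[R]_#|T| :=
  match ty with
  | TypeA => invmx (diag_mx (const_mx 1 *m Mmx K S T))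
  | TypeB => invmx (Mmx K S T)
  end.

Definition Vmx (ty : vtype) K S T : 'M[R]_n :=
  let KSSi := invmx (blk K S S) in
  let KST := blk K S T in
  let KTS := blk K T S in
  let W := VTT ty K S T in
  place (KSSi *m KST *m W *m KTS *m KSSi) + place (- (KSSi *m KST *m W))
  + place (- (W *m KTS *m KSSi)) + place W.

(* The minimizer exists and is unique when 0 < n and pi is positive, so the
   default value 0 is irrelevant. *)
Definition proj pi q : 'cV[R]_n :=
  xget 0 [set q' | simplex q' /\
    forall q'', simplex q'' -> normpi pi (q' - q) <= normpi pi (q'' - q)].

Definition expmx A : 'M[R]_n := limn (series (fun k => k`!%:R^-1 *: A ^+ k)).

Definition Err (ty : vtype) K pi S T (t : R) p : R :=
  normpi pi (proj pi (Vmx ty K S T *m p) - expmx (t *: K) *m p) / normpi pi p.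

Definition maxnorm_off A : R :=
  \big[Num.max/0]_(ij : 'I_n * 'I_n | ij.1 != ij.2) `|A ij.1 ij.2|.

(* Expectation of X (e_i) for i uniform in 'I_n. *)
Definition expectation_basis (X : 'cV[R]_n -> R) : R :=
  n%:R^-1 * \sum_(i < n) X (delta_mx i 0).

End Defs.

(* Moduli of the complex eigenvalues of a real matrix; for m > 0 this set is
   finite and nonempty, so that sup and inf are a maximum and a minimum. *)
Definition eigenvalue_moduli (R : realType) m (A : 'M[R]_m) : set R :=
  [set ComplexField.Normc.normc z |
     z in [set z : R[i] | eigenvalue (map_mx (real_complex R) A) z]].

Definition rho (R : realType) m (A : 'M[R]_m) : R := sup (eigenvalue_moduli A).
Definition sigma (R : realType) m (A : 'M[R]_m) : R := inf (eigenvalue_moduli A).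

Section Bounds.
Variables (R : realType) (n : nat).
Implicit Types (K : 'M[R]_n) (pi : 'cV[R]_n) (S T : {set 'I_n}) (t l : R).

(* l stands for the eigenvalue lambda_k. *)
Definition alpha K S T t l : \bar R :=
  if l == 0 then +oo%E else (rho (schur K S T) / `|l| + expR (t * l))%:E.

Definition beta (ty : vtype) K pi S t l : R :=
  match ty with
  | TypeA => (`|l| + Num.sqrt (2 * maxnorm_off (invmx (Pimx pi) *m K) * `|l|))
             / sigma (blk K S S) + 1 - expR (t * l)
  | TypeB => `|l| / sigma (blk K S S) + 1 - expR (t * l)
  end.

(* min {1, alpha, beta} is finite, hence [fine]. *)
Definition min1ab (ty : vtype) K pi S T t l : R :=
  fine (Order.min 1%:E (Order.min (alpha K S T t l) (beta ty K pi S t l)%:E)).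

End Bounds.

Section Blocks.
Variables (R : realType) (n : nat).
Implicit Types (K A : 'M[R]_n) (I J S T : {set 'I_n}).

Lemma blkE A I J : blk A I J = sel R I *m A *m (sel R J)^T.
Proof.
rewrite /sel -[RHS]trmxK trmx_mul trmxK !mul_rowsub_mx !mul1mx.
by apply/matrixP => i j; rewrite !mxE.
Qed.

Lemma sel_id I : sel R I *m (sel R I)^T = 1%:M.
Proof.
rewrite -[X in X *m _]mulmx1 -blkE; apply/matrixP => i j.
by rewrite !mxE (inj_eq enum_val_inj).
Qed.

Lemma sel_disj I J : I :&: J = finset.set0 -> sel R I *m (sel R J)^T = 0.
Proof.
move=> IJ; rewrite -[X in X *m _]mulmx1 -blkE; apply/matrixP => i j.
rewrite !mxE; case: eqP => // ij; have := enum_valP j.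
by rewrite -ij => jJ; have := finset.in_set0 (enum_val i); rewrite -IJ inE jJ enum_valP.
Qed.

Lemma blkD A A' I J : blk (A + A') I J = blk A I J + blk A' I J.
Proof. by apply/matrixP => i j; rewrite !mxE. Qed.

Lemma blk_place I J (B : 'M[R]_(#|I|, #|J|)) : blk (place B) I J = B.
Proof. by rewrite blkE /place !mulmxA sel_id mul1mx -mulmxA sel_id mulmx1. Qed.

Lemma blk_place_rows I J I' J' (B : 'M[R]_(#|I|, #|J|)) :
  I' :&: I = finset.set0 -> blk (place B) I' J' = 0.
Proof. by move=> d; rewrite blkE /place !mulmxA sel_disj // !mul0mx. Qed.

Lemma blk_place_cols I J I' J' (B : 'M[R]_(#|I|, #|J|)) :
  J :&: J' = finset.set0 -> blk (place B) I' J' = 0.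
Proof. by move=> d; rewrite blkE /place -!mulmxA sel_disj // !mulmx0. Qed.

Lemma Vmx_blocks ty K S T : bipartition S T ->
  [/\ blk (Vmx ty K S T) S S = invmx (blk K S S) *m blk K S T *m VTT ty K S T
                                 *m blk K T S *m invmx (blk K S S),
      blk (Vmx ty K S T) S T =
        - (invmx (blk K S S) *m blk K S T *m VTT ty K S T),
      blk (Vmx ty K S T) T S =
        - (VTT ty K S T *m blk K T S *m invmx (blk K S S))
    & blk (Vmx ty K S T) T T = VTT ty K S T].
Proof.
case=> _ _ ST0 _; have TS0 : T :&: S = finset.set0 by rewrite finset.setIC.
split; rewrite /Vmx /= !blkD blk_place.
- by rewrite blk_place_cols // !blk_place_rows // !addr0.
- by rewrite (blk_place_cols _ _ ST0) !(blk_place_rows _ _ ST0) !addr0 add0r.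
- by rewrite !(blk_place_rows _ _ TS0) (blk_place_cols _ _ TS0) !add0r addr0.
- by rewrite !(blk_place_rows _ _ TS0) (blk_place_cols _ _ ST0) !add0r.
Qed.

End Blocks.

(* Main.v *)
(** Put [E = exp (t K)].  As [E p] is a probability vector, projecting [V p]
    onto the simplex does not increase the distance to it, so the error is at
    most [|(V - E) p| / |p|], and everything follows from the bounds
    [|(V - E) x| <= |x|] and [|(V - E) u_k| <= min (1, alpha_k, beta_k)]; in
    the expectation the Hilbert-Schmidt norm of [V - E] is evaluated in the
    basis [u_k].

    With [W = (- KSS^-1 KST; I)], whose [pi]-adjoint is [W*], one has
    [M = W* W], [V = W L^-1 W*] with [L = M] or [L = diag (1^T M)],
    [W* K = (0, D)], and [x = W x_T + KSS^-1 (K x)_S] for every [x].  From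
    [I <= M <= L] one gets [0 <= V <= I] and [|W L^-1 y| <= |y|], hence
    [|V K x| <= rho(D) |x|], which gives [alpha_k].  For [beta_k], the second
    summand of [u_k] has norm at most [|lambda_k| / sigma(KSS)], and
    [|(I - V) W x|^2 <= <x, (L - M) x>], which is zero in type B.

    In type A let [z = Pi^-1 W x] (harmonic on [S]) and [phi = - KSS^-1 pi_S].
    Then [<x, (L - M) x> = sum_(s in S) phi_s sum_j K_js (z_j - z_s)^2], and
    [0 <= phi_s <= (kappa / sigma(KSS)^2) pi_s], where [kappa] is the largest
    off-diagonal entry of [Pi^-1 K]; so the form is at most
    [2 kappa / sigma(KSS)^2] times the Dirichlet energy of [z], which is
    minimal among all extensions of [x / pi_T]. *)
Require Import Defs.
From mathcomp Require Import all_boot all_order all_algebra.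
From mathcomp Require Import boolp classical_sets reals constructive_ereal.
From mathcomp Require Import topology normedtype sequences exp.
From mathcomp Require Import ring lra.
From mathcomp.real_closed Require Import complex.
From mathcomp Require Import spectral.
Set Implicit Arguments.
Unset Strict Implicit.
Unset Printing Implicit Defensive.
Import Order.TTheory GRing.Theory Num.Theory.
Import numFieldNormedType.Exports.

Local Open Scope ring_scope.

(** * Weighted inner products *)

Section WeightedDot.
Variables (R : realType) (m : nat) (w : 'cV[R]_m).
Implicit Types (a b x y : 'cV[R]_m) (c : R).

Lemma dotpiDl a b y : dotpi w (a + b) y = dotpi w a y + dotpi w b y.
Proof. by rewrite /dotpi linearD /= !mulmxDl mxE. Qed.

Lemma dotpiDr a b y : dotpi w y (a + b) = dotpi w y a + dotpi w y b.
Proof. by rewrite /dotpi mulmxDr mxE. Qed.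

Lemma dotpiZl c a y : dotpi w (c *: a) y = c * dotpi w a y.
Proof. by rewrite /dotpi linearZ /= -!scalemxAl mxE. Qed.

Lemma dotpiZr c a y : dotpi w y (c *: a) = c * dotpi w y a.
Proof. by rewrite /dotpi -!scalemxAr mxE. Qed.

Lemma dotpiNl a y : dotpi w (- a) y = - dotpi w a y.
Proof. by rewrite -scaleN1r dotpiZl mulN1r. Qed.

Lemma dotpiNr a y : dotpi w y (- a) = - dotpi w y a.
Proof. by rewrite -scaleN1r dotpiZr mulN1r. Qed.

Lemma dotpi_suml (I : Type) (s : seq I) (P : pred I) (F : I -> 'cV[R]_m) y :
  dotpi w (\sum_(i <- s | P i) F i) y = \sum_(i <- s | P i) dotpi w (F i) y.
Proof.
apply: (big_morph (dotpi w ^~ y)) => [a b|]; first exact: dotpiDl.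
by rewrite -(scale0r 0) dotpiZl mul0r.
Qed.

Lemma dotpi_sumr (I : Type) (s : seq I) (P : pred I) (F : I -> 'cV[R]_m) y :
  dotpi w y (\sum_(i <- s | P i) F i) = \sum_(i <- s | P i) dotpi w y (F i).
Proof.
apply: (big_morph (dotpi w y)) => [a b|]; first exact: dotpiDr.
by rewrite -(scale0r 0) dotpiZr mul0r.
Qed.

Lemma dotpiC a b : dotpi w a b = dotpi w b a.
Proof.
rewrite /dotpi.
have -> : b^T *m invmx (Pimx w) *m a = (a^T *m invmx (Pimx w) *m b)^T.
  by rewrite !trmx_mul trmxK trmx_inv tr_diag_mx mulmxA.
by rewrite [RHS]mxE.
Qed.

Definition dotpi_lin := (dotpiDl, dotpiDr, dotpiNl, dotpiNr, dotpiZl, dotpiZr).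

Hypothesis w_gt0 : forall i, 0 < w i 0.

Lemma invmx_Pimx : invmx (Pimx w) = diag_mx (\row_i (w i 0)^-1).
Proof.
have e : Pimx w *m diag_mx (\row_i (w i 0)^-1) = 1%:M.
  rewrite mulmx_diag; apply/matrixP => i j; rewrite !mxE.
  by case: eqP => // ->; rewrite !mulr1n mulfV// gt_eqF.
have [u _] := mulmx1_unit e.
by rewrite -[LHS]mulmx1 -e mulmxA mulVmx// mul1mx.
Qed.

Lemma dotpiE a b : dotpi w a b = \sum_i a i 0 * b i 0 / w i 0.
Proof.
rewrite /dotpi invmx_Pimx mul_mx_diag mxE; apply: eq_bigr => i _.
by rewrite !mxE mulrAC.
Qed.

Lemma dotpi_weight a : dotpi w w a = \sum_i a i 0.
Proof.
rewrite dotpiE; apply: eq_bigr => i _.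
by rewrite mulrAC mulfV ?mul1r// gt_eqF.
Qed.

Lemma dotpi_ge0 a : 0 <= dotpi w a a.
Proof.
rewrite dotpiE sumr_ge0// => i _; rewrite divr_ge0 ?(ltW (w_gt0 i))//.
exact: sqr_ge0.
Qed.

Lemma dotpi_eq0 a : dotpi w a a = 0 -> a = 0.
Proof.
rewrite dotpiE => /eqP; rewrite psumr_eq0 => [/allP h|i _]; last first.
  by rewrite divr_ge0 ?(ltW (w_gt0 i))//; apply: sqr_ge0.
apply/matrixP => i j; rewrite ord1 mxE; have /eqP := h i (mem_index_enum i).
move/eqP; rewrite mulf_eq0 invr_eq0 (gt_eqF (w_gt0 i)) orbF mulf_eq0 orbb.
by move/eqP.
Qed.

Lemma normpi_ge0 a : 0 <= normpi w a.
Proof. exact: sqrtr_ge0. Qed.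

Lemma normpi_sqr a : normpi w a ^+ 2 = dotpi w a a.
Proof. by rewrite sqr_sqrtr// dotpi_ge0. Qed.

Lemma normpi_le a b :
  (normpi w a <= normpi w b) = (dotpi w a a <= dotpi w b b).
Proof. by rewrite ler_sqrt// dotpi_ge0. Qed.

Lemma normpi_le_sqr a c :
  0 <= c -> (normpi w a <= c) = (dotpi w a a <= c ^+ 2).
Proof.
by move=> c0; rewrite -normpi_sqr ler_pXn2r// nnegrE normpi_ge0.
Qed.

Lemma normpi_eq0 a : normpi w a = 0 -> a = 0.
Proof. by move=> h; apply: dotpi_eq0; rewrite -normpi_sqr h expr0n. Qed.

Lemma normpiN a : normpi w (- a) = normpi w a.
Proof. by rewrite /normpi !dotpi_lin opprK. Qed.

Lemma normpiZ c a : normpi w (c *: a) = `|c| * normpi w a.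
Proof.
by rewrite /normpi !dotpi_lin mulrA -expr2 sqrtrM ?sqr_ge0// sqrtr_sqr.
Qed.

Lemma dotpi_le_norm a b : dotpi w a b <= normpi w a * normpi w b.
Proof.
have [a0|a_neq0] := eqVneq (normpi w a) 0.
  by rewrite (normpi_eq0 a0) -(scale0r 0) dotpiZl normpiZ normr0 !mul0r.
have [b0|b_neq0] := eqVneq (normpi w b) 0.
  by rewrite (normpi_eq0 b0) -(scale0r 0) dotpiZr normpiZ normr0 !mul0r mulr0.
have a_gt0 : 0 < normpi w a by rewrite lt_def a_neq0 normpi_ge0.
have b_gt0 : 0 < normpi w b by rewrite lt_def b_neq0 normpi_ge0.
(* Cauchy-Schwarz: this squared norm equals [2 |a| |b| (|a| |b| - <a, b>)]. *)
have := dotpi_ge0 (normpi w b *: a - normpi w a *: b).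
rewrite !dotpi_lin (dotpiC b a) -!normpi_sqr.
move: (normpi w a) (normpi w b) (dotpi w a b) a_gt0 b_gt0 => s r d s0 r0 h.
have : 0 <= 2 * (s * r) * (s * r - d) by nra.
by rewrite pmulr_rge0 ?subr_ge0// !mulr_gt0.
Qed.

Lemma ler_normpiD a b : normpi w (a + b) <= normpi w a + normpi w b.
Proof.
rewrite normpi_le_sqr ?addr_ge0 ?normpi_ge0// !dotpi_lin (dotpiC b a).
have := dotpi_le_norm a b; rewrite -!normpi_sqr; nra.
Qed.

Lemma ler_normpi_sum (I : Type) (s : seq I) (P : pred I) (F : I -> 'cV[R]_m) :
  normpi w (\sum_(i <- s | P i) F i) <= \sum_(i <- s | P i) normpi w (F i).
Proof.
apply: (big_ind2 (fun a c => normpi w a <= c)) => // [|a c b d ha hb].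
  by rewrite -(scale0r 0) normpiZ normr0 mul0r.
by rewrite (le_trans (ler_normpiD _ _))// lerD.
Qed.

(* Polarization: the extreme values of the quadratic form bound the norm. *)
Lemma selfadjoint_contraction (X : 'M[R]_m) :
  (forall x y, dotpi w (X *m x) y = dotpi w x (X *m y)) ->
  (forall x, `|dotpi w x (X *m x)| <= dotpi w x x) ->
  forall x, normpi w (X *m x) <= normpi w x.
Proof.
move=> Xadj Xle x; rewrite normpi_le.
(* The difference of the two forms is [4 |X x|^2], while the two bounds add up to
   [2 |x|^2 + 2 |X x|^2]. *)
have := Xle (x + X *m x); have := Xle (x - X *m x).
rewrite !ler_norml !mulmxDr !mulmxN !dotpi_lin (dotpiC (X *m x) x).
have e1 : dotpi w (X *m x) (X *m x) = dotpi w x (X *m (X *m x)) by apply: Xadj.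
by rewrite -!e1 => /andP[? ?] /andP[? ?]; lra.
Qed.

Lemma posdef_unitmx (X : 'M[R]_m) :
  (forall x, dotpi w x x <= dotpi w x (X *m x)) -> X \in unitmx.
Proof.
move=> Xge; rewrite -unitmx_tr -row_free_unit -kermx_eq0; apply/eqP.
apply/row_matrixP => i; rewrite row0.
have : row i (kermx X^T) *m X^T = 0 by rewrite -row_mul mulmx_ker row0.
set v := row i _ => /(congr1 trmx); rewrite trmx_mul trmxK trmx0 => Xv.
apply: trmx_inj; rewrite trmx0; apply: dotpi_eq0; apply/eqP.
rewrite eq_le dotpi_ge0 andbT; have := Xge v^T; rewrite Xv.
by rewrite -(scale0r 0) dotpiZr mul0r.
Qed.

End WeightedDot.

(** * Adjoints between weighted spaces *)

Section Adjoint.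
Variable R : realType.

Definition adjoint m1 m2 (w1 : 'cV[R]_m1) (w2 : 'cV[R]_m2)
    (A : 'M[R]_(m1, m2)) (B : 'M[R]_(m2, m1)) :=
  forall x y, dotpi w1 (A *m x) y = dotpi w2 x (B *m y).

Variables (m1 m2 m3 : nat) (w1 : 'cV[R]_m1) (w2 : 'cV[R]_m2) (w3 : 'cV[R]_m3).

(** In coordinates adjointness is detailed balance: for [A = B = K] with both weights [pi], the
    entrywise condition is reversibility. *)
Lemma adjoint_entries (A : 'M_(m1, m2)) (B : 'M_(m2, m1)) :
  (forall i, 0 < w1 i 0) -> (forall i, 0 < w2 i 0) ->
  (forall i j, A i j * w2 j 0 = B j i * w1 i 0) -> adjoint w1 w2 A B.
Proof.
move=> p1 p2 AB x y; rewrite !dotpiE//.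
under eq_bigr do rewrite mxE !mulr_suml.
under [RHS]eq_bigr do rewrite mxE mulr_sumr mulr_suml.
rewrite exchange_big; apply: eq_bigr => j _; apply: eq_bigr => i _ /=.
have -> : A i j = B j i * w1 i 0 / w2 j 0 by rewrite -AB mulfK// gt_eqF.
have := gt_eqF (p1 i); have := gt_eqF (p2 j).
by move=> /negbT h1 /negbT h2; field; rewrite h1.
Qed.

Lemma adjoint_entriesV (A : 'M_(m1, m2)) (B : 'M_(m2, m1)) i j :
  (forall i, 0 < w1 i 0) -> (forall i, 0 < w2 i 0) ->
  adjoint w1 w2 A B -> A i j * w2 j 0 = B j i * w1 i 0.
Proof.
move=> p1 p2 /(_ (delta_mx j 0) (delta_mx i 0)).
rewrite -!colE !dotpiE// (bigD1 i)//= big1 ?addr0 => [|k /negbTE ki]; last first.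
  by rewrite !mxE ki mulr0 mul0r.
rewrite [RHS](bigD1 j)//= big1 ?addr0 => [|k /negbTE kj]; last first.
  by rewrite !mxE kj !mul0r.
rewrite !mxE !eqxx mulr1 mul1r => /eqP.
by rewrite eqr_div ?(gt_eqF (p1 _)) ?(gt_eqF (p2 _))// => /eqP.
Qed.

Lemma adjointC A B : adjoint w1 w2 A B -> adjoint w2 w1 B A.
Proof. by move=> AB x y; rewrite dotpiC -AB dotpiC. Qed.

Lemma adjointM A B (C : 'M_(m2, m3)) D :
  adjoint w1 w2 A B -> adjoint w2 w3 C D -> adjoint w1 w3 (A *m C) (D *m B).
Proof. by move=> AB CD x y; rewrite -!mulmxA AB CD. Qed.

Lemma adjointB A B A' B' : adjoint w1 w2 A B -> adjoint w1 w2 A' B' ->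
  adjoint w1 w2 (A - A') (B - B').
Proof. by move=> AB AB' x y; rewrite !mulmxBl !dotpi_lin AB AB'. Qed.

Lemma adjoint1 : adjoint w1 w1 1%:M 1%:M.
Proof. by move=> x y; rewrite !mul1mx. Qed.

Lemma adjoint_inv A : A \in unitmx -> adjoint w1 w1 A A ->
  adjoint w1 w1 (invmx A) (invmx A).
Proof. by move=> uA AA x y; rewrite -[y in LHS](mulKVmx uA) -AA mulKVmx. Qed.

End Adjoint.

Lemma adjoint_diag (R : realType) m (w : 'cV[R]_m) (d : 'rV[R]_m) :
  (forall i, 0 < w i 0) ->
  adjoint w w (diag_mx d) (diag_mx d).
Proof.
move=> w_gt0; apply: adjoint_entries => // i j; rewrite !mxE eq_sym.
by have [->|_] := eqVneq j i; rewrite ?mulr0n ?mul0r.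
Qed.

(** * Eigenvalues of self-adjoint matrices *)

Section Spectral.
Variable R : realType.

(** A complex unitary [P] diagonalizes [B] with real spectrum; [xi y i] is the squared modulus of
    [(P y)_i]. These weights determine the quadratic forms below, so no real eigenvectors have to be
    extracted. *)
Lemma symmetric_spectral m (B : 'M[R]_m) : B^T = B ->
  exists (r : 'I_m -> R) (xi : 'cV[R]_m -> 'I_m -> R),
    (forall i, eigenvalue B (r i)) /\
    forall y, [/\ forall i, 0 <= xi y i,
      (y^T *m y) 0 0 = \sum_i xi y i,
      (y^T *m (B *m y)) 0 0 = \sum_i r i * xi y i
    & ((B *m y)^T *m (B *m y)) 0 0 = \sum_i r i ^+ 2 * xi y i].
Proof.
move=> symB; pose toC := real_complex R.
have toC_real (x : R) : toC x \is Num.real by rewrite complex_real.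
pose BC := map_mx toC B; pose P := spectralmx BC; pose sp := spectral_diag BC.
have BCreal : BC \is a mxOver Num.real by apply/mxOverP => i j; rewrite mxE.
have BCherm : BC \is hermsymmx.
  apply: realsym_hermsym => //; apply/is_hermitianmxP.
  by rewrite expr0 scale1r map_mx_id// map_trmx symB.
have Punit : P \is unitarymx := spectral_unitarymx BC.
have BCE : BC = P^t*%sesqui *m diag_mx sp *m P.
  by rewrite -invmx_unitary//; apply/orthomx_spectralP/hermitian_normalmx.
have spE i : sp 0 i = toC (complex.Re (sp 0 i)).
  by apply/esym/RRe_real; apply/(mxOverP (hermitian_spectral_diag_real BCherm)).
pose r i := complex.Re (sp 0 i).
pose q (y : 'cV[R]_m) : 'cV_m := P *m map_mx toC y.
exists r, (fun y i => ComplexField.Normc.normc (q y i 0) ^+ 2).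
have PV : P^t*%sesqui *m P = 1%:M.
  by rewrite -invmx_unitary// mulVmx// unitarymx_unit.
(* As [y] is real, [y^T P^*] is the conjugate transpose of [P y]. *)
have quadr (d : 'rV_m) (y : 'cV[R]_m) :
    ((map_mx toC y)^T *m (P^t*%sesqui *m diag_mx d *m P) *m map_mx toC y) 0 0
    = \sum_i d 0 i * `|q y i 0| ^+ 2.
  rewrite !mulmxA -[_ *m P *m _]mulmxA.
  have -> : (map_mx toC y)^T *m P^t*%sesqui = (q y)^t*%sesqui.
    rewrite /q trmx_mul map_mxM /=; congr (_ *m _); apply/matrixP => i j.
    by rewrite !mxE; apply/esym/CrealP.
  rewrite -/(q y) mul_mx_diag mxE; apply: eq_bigr => i _.
  by rewrite !mxE normCK mulrAC [d 0 i * _]mulrC [_ * _ ^*]mulrC.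
split=> [i|y].
  suff : eigenvalue BC (sp 0 i) by rewrite spE (eigenvalue_map (real_complex R)).
  apply/eigenvalueP.
  exists (row i P).
    rewrite -row_mul {1}BCE !mulmxA (unitarymxP Punit) mul1mx.
    by rewrite row_mul row_diag_mx -scalemxAl -rowE.
  apply/negP => /eqP Pi0; have := spectral_unit BC; rewrite -/P.
  move=> /mulmxV/(congr1 (row i)); rewrite row_mul Pi0 mul0mx row1.
  move=> /rowP/(_ i)/eqP; rewrite !mxE !eqxx /=.
  by rewrite eq_sym oner_eq0.
have toCM k l p (A : 'M[R]_(k, l)) (A' : 'M_(l, p)) :
  map_mx toC (A *m A') = map_mx toC A *m map_mx toC A' := map_mxM _ _ _.
have toC_sum (d : 'I_m -> R) : \sum_i toC (d i) * `|q y i 0| ^+ 2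
    = toC (\sum_i d i * ComplexField.Normc.normc (q y i 0) ^+ 2).
  by rewrite /toC rmorph_sum; apply: eq_bigr => i _; rewrite rmorphM rmorphXn.
split=> [i|||].
- exact: sqr_ge0.
- apply: (@complexI R); rewrite -/toC.
  have -> : toC ((y^T *m y) 0 0) = (map_mx toC (y^T *m y)) 0 0 by rewrite [RHS]mxE.
  under eq_bigr => i do rewrite -[_ ^+ 2]mul1r.
  rewrite -toC_sum toCM -map_trmx -[X in X *m _]mulmx1 -PV.
  rewrite -[X in X *m P]mulmx1 -diag_const_mx quadr.
  by apply: eq_bigr => i _; rewrite mxE /toC rmorph1.
- apply: (@complexI R); rewrite -/toC.
  have -> : toC ((y^T *m (B *m y)) 0 0) = (map_mx toC (y^T *m (B *m y))) 0 0.
    by rewrite [RHS]mxE.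
  rewrite -toC_sum !toCM -map_trmx mulmxA -/BC BCE quadr.
  by apply: eq_bigr => i _; rewrite -spE.
- apply: (@complexI R); rewrite -/toC trmx_mul symB.
  set Z := _ *m (B *m y).
  have -> : toC (Z 0 0) = (map_mx toC Z) 0 0 by rewrite [RHS]mxE.
  rewrite -toC_sum !toCM -map_trmx !mulmxA -(mulmxA _ _ (map_mx toC B)).
  have -> : map_mx toC B *m map_mx toC B =
      P^t*%sesqui *m diag_mx (\row_i (sp 0 i ^+ 2)) *m P.
    rewrite -/BC BCE -!mulmxA (mulmxA P) (unitarymxP Punit) mul1mx.
    congr (_ *m _); rewrite !mulmxA; congr (_ *m _).
    by rewrite mulmx_diag; congr diag_mx; apply/rowP => i; rewrite !mxE.
  by rewrite quadr; apply: eq_bigr => i _; rewrite mxE spE /toC rmorphXn.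
Qed.

End Spectral.

Section SelfAdjointEigenvalues.
Variables (R : realType) (m : nat) (w : 'cV[R]_m) (A : 'M[R]_m).
Hypothesis w_gt0 : forall i, 0 < w i 0.
Hypothesis A_adj : adjoint w w A A.

Let Asym i j : A i j * w j 0 = A j i * w i 0.
Proof. exact: adjoint_entriesV. Qed.

(** Conjugation by [s = diag (sqrt w)] turns [A] into the symmetric matrix [B = s^-1 A s], and
    [x -> s^-1 x] is an isometry onto the Euclidean space. *)
Lemma selfadjoint_spectral :
  exists (r : 'I_m -> R) (xi : 'cV[R]_m -> 'I_m -> R),
    (forall i, eigenvalue A (r i)) /\
    forall x, [/\ forall i, 0 <= xi x i,
      dotpi w x x = \sum_i xi x i,
      dotpi w x (A *m x) = \sum_i r i * xi x i
    & dotpi w (A *m x) (A *m x) = \sum_i r i ^+ 2 * xi x i].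
Proof.
pose s i := Num.sqrt (w i 0).
have s_gt0 i : 0 < s i by rewrite sqrtr_gt0.
have s_neq0 i : s i != 0 by rewrite gt_eqF.
have s2 i : s i ^+ 2 = w i 0 by rewrite sqr_sqrtr// ltW.
pose B := \matrix_(i, j) (A i j * s j / s i).
pose y (x : 'cV[R]_m) := \col_i (x i 0 / s i).
have symB : B^T = B.
  apply/matrixP => i j; rewrite !mxE; apply/eqP.
  rewrite eqr_div// -!mulrA -!expr2 !s2; apply/eqP; exact/esym.
have yE a b : ((y a)^T *m y b) 0 0 = dotpi w a b.
  rewrite dotpiE// mxE; apply: eq_bigr => i _; rewrite !mxE -s2.
  by field; rewrite s_neq0.
have By x : B *m y x = y (A *m x).
  apply/matrixP => i j; rewrite !mxE mulr_suml; apply: eq_bigr => k _.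
  by rewrite !mxE; field; rewrite !s_neq0.
have [r [xi [reig xiE]]] := symmetric_spectral symB.
exists r, (fun x => xi (y x)); split=> [i|x]; last first.
  by have [xi0 e1 e2 e3] := xiE (y x); split=> //; rewrite -?e1 -?e2 -?e3 ?By yE.
have /eigenvalueP[v vB v0] := reig i; apply/eigenvalueP.
exists (\row_j (v 0 j / s j)).
  apply/rowP => j; have /rowP/(_ j) := vB.
  rewrite !mxE => /(congr1 (fun z => z / s j)).
  rewrite -mulrA => <-; rewrite mulr_suml; apply: eq_bigr => k _.
  by rewrite !mxE; field; rewrite !s_neq0.
apply: contra v0 => /eqP/rowP h; apply/eqP/rowP => j.
have /eqP := h j; rewrite !mxE mulf_eq0 invr_eq0 (negbTE (s_neq0 j)) orbF.
by move/eqP.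
Qed.

Lemma eigenvalue_le0 (r : R) : (forall x, dotpi w x (A *m x) <= 0) ->
  eigenvalue A r -> r <= 0.
Proof.
move=> Ale0 /eigenvalueP[v vA v0].
(* Detailed balance turns the row eigenvector [v] into the column eigenvector [w v]. *)
pose x := \col_j (v 0 j * w j 0).
have Ax : A *m x = r *: x.
  apply/matrixP => i j; rewrite !mxE mulrA.
  have /rowP/(_ i) := vA; rewrite !mxE => <-; rewrite mulr_suml.
  by apply: eq_bigr => k _; rewrite !mxE mulrCA Asym mulrA.
have x0 : x != 0.
  apply: contra v0 => /eqP/matrixP h; apply/eqP/rowP => j.
  by have /eqP := h j 0; rewrite !mxE mulf_eq0 (gt_eqF (w_gt0 j)) orbF => /eqP.
have := Ale0 x; rewrite Ax dotpiZr pmulr_lle0// lt_def dotpi_ge0// andbT.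
by apply: contra x0 => /eqP/dotpi_eq0 => ->.
Qed.

End SelfAdjointEigenvalues.

(** * Extreme moduli of eigenvalues *)

Section EigenvalueModuli.
Variables (R : realType) (m : nat).
Implicit Types A : 'M[R]_m.

Lemma eigenvalue_moduli_real A (r : R) :
  eigenvalue A r -> eigenvalue_moduli A `|r|.
Proof.
move=> Ar; exists (r%:C)%C; first by rewrite /= eigenvalue_map.
by rewrite /= expr0n addr0 sqrtr_sqr.
Qed.

(** The roots of the characteristic polynomial form a finite list; this bounds the moduli above and
    keeps the nonzero ones away from 0. *)
Lemma complex_eigenvalues_finite A : exists s : seq R[i],
  forall z, eigenvalue (map_mx (real_complex R) A) z -> z \in s.
Proof.
set C := map_mx _ _; have [s sE] := closed_field_poly_normal (char_poly C).
exists s => z; rewrite eigenvalue_root_char sE (monicP (char_poly_monic _)).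
by rewrite scale1r root_prod_XsubC.
Qed.

Lemma eigenvalue_moduli_ubound A : has_ubound (eigenvalue_moduli A).
Proof.
have [s sP] := complex_eigenvalues_finite A.
exists (\big[Num.max/0]_(z <- s) ComplexField.Normc.normc z) => _ [z /= /sP zs <-].
exact: le_bigmax_seq.
Qed.

Lemma eigenvalue_moduli_ge0 A x : eigenvalue_moduli A x -> 0 <= x.
Proof. by case=> [[a b]] _ <- /=; apply: sqrtr_ge0. Qed.

Lemma le_rho A (r : R) : eigenvalue A r -> `|r| <= rho A.
Proof.
move=> Ar; apply: ub_le_sup; first exact: eigenvalue_moduli_ubound.
exact: eigenvalue_moduli_real.
Qed.

Lemma sigma_le A (r : R) : eigenvalue A r -> sigma A <= `|r|.
Proof.
move=> Ar; apply: ge_inf; last exact: eigenvalue_moduli_real.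
by exists 0 => x; apply: eigenvalue_moduli_ge0.
Qed.

Lemma sigma_gt0 A : (0 < m)%N -> A \in unitmx -> 0 < sigma A.
Proof.
move=> m0 Au; have [s sP] := complex_eigenvalues_finite A.
(* Skipping the root 0 and starting the minimum at 1 makes [c] positive; it bounds all moduli below
   because 0 is not an eigenvalue of an invertible matrix. *)
pose c := \big[Num.min/1]_(z <- s | z != 0) ComplexField.Normc.normc z.
have c0 : 0 < c.
  apply: lt_bigmin => // z z0; rewrite lt_def; apply/andP; split.
    by apply: contra z0 => /eqP/ComplexField.Normc.eq0_normc => ->.
  by case: z {z0} => a b /=; apply: sqrtr_ge0.
apply: (lt_le_trans c0); apply: lb_le_inf.
  have [z Az] := eigenvalue_closed (map_mx (real_complex R) A) m0.
  by exists (ComplexField.Normc.normc z), z.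
move=> _ [z /= Az <-]; apply: ge_bigmin_seq; first exact: sP.
apply/negP => /eqP z0; move: Az; rewrite z0 => /eigenvalueP[v].
rewrite scale0r => /(congr1 (mulmx ^~ (invmx (map_mx (real_complex R) A)))).
by rewrite mulmxK ?map_unitmx// mul0mx => ->; rewrite eqxx.
Qed.

Variable w : 'cV[R]_m.
Hypothesis w_gt0 : forall i, 0 < w i 0.

Lemma normpi_le_rho A x : (0 < m)%N ->
  adjoint w w A A ->
  normpi w (A *m x) <= rho A * normpi w x.
Proof.
move=> m0 A_adj; have [r [xi [reig xiE]]] := selfadjoint_spectral w_gt0 A_adj.
have [xi0 e1 _ e3] := xiE x.
have rho0 : 0 <= rho A := le_trans (normr_ge0 _) (le_rho (reig (Ordinal m0))).
rewrite normpi_le_sqr ?mulr_ge0 ?normpi_ge0// exprMn normpi_sqr// e1 e3.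
rewrite mulr_sumr ler_sum// => i _; rewrite ler_wpM2r//.
by rewrite -real_normK ?num_real// ler_pXn2r ?nnegrE// le_rho.
Qed.

(** All eigenvalues are nonpositive, so [- r i = |r i| >= sigma A] in the spectral expansion of the
    form. *)
Lemma sigma_le_quadr A x :
  adjoint w w A A ->
  (forall x, dotpi w x (A *m x) <= 0) ->
  sigma A * dotpi w x x <= - dotpi w x (A *m x).
Proof.
move=> A_adj Ale0; have [r [xi [reig xiE]]] := selfadjoint_spectral w_gt0 A_adj.
have [xi0 e1 e2 _] := xiE x; rewrite e1 e2 mulr_sumr -sumrN ler_sum// => i _.
rewrite -mulNr ler_wpM2r// -ler0_norm ?sigma_le//.
exact: (eigenvalue_le0 w_gt0 A_adj Ale0 (reig i)).
Qed.

End EigenvalueModuli.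

(** * Projection onto the simplex *)

Lemma cvg_sum_fin (R : numFieldType) (V : normedModType R)
    (T : Type) (F : set_system T)
    (I : Type) (s : seq I) (f : I -> T -> V) (l : I -> V) : Filter F ->
  (forall i, f i x @[x --> F] --> l i)%classic ->
  (\sum_(i <- s) f i x @[x --> F] --> \sum_(i <- s) l i)%classic.
Proof.
move=> FF fl; elim: s => [|i s IHs].
  by rewrite big_nil; under eq_fun do rewrite big_nil; apply: cvg_cst.
by rewrite big_cons; under eq_fun do rewrite big_cons; apply: cvgD.
Qed.

Section Projection.
Variables (R : realType) (n : nat) (pi : 'cV[R]_n).
Hypothesis pi_simplex : open_simplex pi.

Let pi_gt0 i : 0 < pi i 0. Proof. by case: pi_simplex. Qed.

(* The minimizer is the truncation [max (q - mu pi) 0], with the multiplier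
   [mu] fixed by the condition that the coordinates sum to 1. *)
Lemma exists_simplex_projection (q : 'cV[R]_n) : exists2 q', simplex q' &
  forall x, simplex x -> 0 <= dotpi pi (x - q') (q' - q).
Proof.
pose f mu := \sum_i Num.max (q i 0 - mu * pi i 0) 0.
have fcont : continuous f.
  move=> mu; apply: cvg_sum_fin => i.
  apply: (@continuous_max R R^o (fun mu : R^o => q i 0 - mu * pi i 0) (fun=> 0)).
    by apply: cvgB; [exact: cvg_cst|apply: cvgMl; exact: cvg_id].
  exact: cvg_cst.
(* Bracket for the multiplier: at [lo] the untruncated coordinates already sum to 1, and at [hi]
   every truncated coordinate vanishes. *)
pose lo := \sum_i q i 0 - 1.
pose hi := \big[Num.max/lo]_i (q i 0 / pi i 0).
have lohi : lo <= hi by apply: bigmax_ge_id.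
have flo : 1 <= f lo.
  have e : 1 = \sum_i (q i 0 - lo * pi i 0).
    rewrite sumrB -mulr_sumr; case: pi_simplex => _ ->.
    by rewrite mulr1 opprB addrC subrK.
  by rewrite {1}e; apply: ler_sum => i _; rewrite le_max lexx.
have fhi : f hi <= 1.
  rewrite /f big1 ?ler01// => i _; apply/max_idPr.
  by rewrite subr_le0 -ler_pdivrMr// /hi; apply: le_bigmax.
have [|mu _ fmu] := IVT lohi (continuous_subspaceT fcont) (v := 1).
  by rewrite ge_min fhi orbT le_max flo.
exists (\col_i Num.max (q i 0 - mu * pi i 0) 0).
  split=> [i|]; first by rewrite mxE le_max lexx orbT.
  by rewrite -[RHS]fmu; apply: eq_bigr => i _; rewrite mxE.
move=> x [x_ge0 x_sum]; rewrite dotpiE//.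
(* Both points have mass 1, so 0 can be written as this sum and compared termwise: untruncated terms
   agree, and a truncated one uses [x_i >= 0] and [q_i <= mu pi_i]. *)
rewrite [leLHS](_ : _ = \sum_i (x i 0 - Num.max (q i 0 - mu * pi i 0) 0) * - mu).
  2: by rewrite -mulr_suml sumrB x_sum [X in 1 - X]fmu subrr mul0r.
apply: ler_sum => i _; rewrite !mxE.
have [h|h] := leP (q i 0 - mu * pi i 0) 0.
  rewrite subr0 sub0r -mulrA ler_wpM2l// mulNr lerNl opprK.
  by rewrite ler_pdivrMr// -subr_le0.
rewrite le_eqVlt -mulrA; apply/orP; left; apply/eqP; congr (_ * _).
by field; rewrite gt_eqF.
Qed.

(** By the variational inequality, the cross term in the expansion of [|z - q|^2] about [q'] is
    nonnegative for [z] in the simplex. Hence [q'] is the unique minimizer, so it equals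
    [proj pi q], and [z = x] gives the claim. *)
Lemma proj_le q x : simplex x ->
  normpi pi (proj pi q - x) <= normpi pi (q - x).
Proof.
move=> x_simplex; have [q' q'_simplex q'P] := exists_simplex_projection q.
have pyth z : dotpi pi (z - q) (z - q) = dotpi pi (z - q') (z - q')
    + 2 * dotpi pi (z - q') (q' - q) + dotpi pi (q' - q) (q' - q).
  rewrite -[X in dotpi pi X X](subrKA q') !(dotpiDl pi (z - q')).
  rewrite !(dotpiDr pi (z - q')).
  by rewrite (dotpiC pi (q' - q) (z - q')); ring.
have [r_simplex rP] : [set r | simplex r /\ forall q'', simplex q'' ->
    normpi pi (r - q) <= normpi pi (q'' - q)]%classic (proj pi q).
  apply: xgetPex; exists q'; split=> // z z_simplex.
  rewrite normpi_le// [leRHS]pyth lerDr addr_ge0 ?dotpi_ge0//.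
  by rewrite mulr_ge0// q'P.
have -> : proj pi q = q'.
  apply/eqP; rewrite -subr_eq0; apply/eqP/(dotpi_eq0 pi_gt0).
  apply/eqP; rewrite eq_le dotpi_ge0// andbT.
  have := rP q' q'_simplex; rewrite normpi_le// [leLHS]pyth.
  by have := q'P _ r_simplex; lra.
rewrite -(normpiN _ (q - x)) opprB -(normpiN _ (q' - x)) opprB normpi_le//.
rewrite [leRHS]pyth -addrA lerDl addr_ge0 ?dotpi_ge0//.
by rewrite mulr_ge0// q'P.
Qed.

End Projection.

(** * The semigroup generated by a rate constant matrix *)

Section SpectralCalculus.
Variables (R : realType) (n : nat) (pi : 'cV[R]_n) (u : 'I_n -> 'cV[R]_n).
Hypothesis pi_gt0 : forall i, 0 < pi i 0.
Hypothesis u_ortho : forall i j, dotpi pi (u i) (u j) = (i == j)%:R.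
Implicit Types (x y : 'cV[R]_n) (a b c : 'I_n -> R).

Lemma cV_ext (A B : 'M[R]_n) : (forall x : 'cV_n, A *m x = B *m x) -> A = B.
Proof.
move=> AB; apply/matrixP => i j; have /matrixP/(_ i 0) := AB (delta_mx j 0).
by rewrite -!colE !mxE.
Qed.

(** Orthonormality says that [U^T Pi^-1] is a left inverse of the square matrix [U], hence also a
    right inverse. *)
Lemma orthonormal_expansion x : x = \sum_k dotpi pi (u k) x *: u k.
Proof.
pose U := \matrix_(i, k) u k i 0.
have UV : U *m (U^T *m invmx (Pimx pi)) = 1%:M.
  apply: mulmx1C; apply/matrixP => i j; rewrite [RHS]mxE -u_ortho /dotpi !mxE.
  apply: eq_bigr => k _; rewrite !mxE; congr (_ * _).
  by apply: eq_bigr => l _; rewrite !mxE.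
rewrite -[LHS]mul1mx -UV -mulmxA; apply/matrixP => i j.
rewrite summxE mxE; apply: eq_bigr => k _; rewrite !mxE mulrC ord1; congr (_ * _).
rewrite /dotpi mxE; apply: eq_bigr => l _; rewrite !mxE; congr (_ * _).
by apply: eq_bigr => h _; rewrite !mxE.
Qed.

Lemma parseval x y : dotpi pi x y = \sum_k dotpi pi (u k) x * dotpi pi (u k) y.
Proof.
rewrite {1}(orthonormal_expansion x) dotpi_suml.
by apply: eq_bigr => k _; rewrite dotpiZl.
Qed.

Definition eigenproj k : 'M[R]_n := u k *m ((u k)^T *m invmx (Pimx pi)).
(** Spectral calculus: the operator with eigenvalue [a k] on [u k]. Limits and powers reduce to
    scalars, since the projections are fixed. *)
Definition specfun a : 'M[R]_n := \sum_k a k *: eigenproj k.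

Lemma eigenproj_mul k x : eigenproj k *m x = dotpi pi (u k) x *: u k.
Proof.
by rewrite /eigenproj /dotpi -mulmxA [X in _ *m X]mx11_scalar mul_mx_scalar.
Qed.

Lemma specfun_mul a x :
  specfun a *m x = \sum_k (a k * dotpi pi (u k) x) *: u k.
Proof.
rewrite mulmx_suml; apply: eq_bigr => k _.
by rewrite -scalemxAl eigenproj_mul scalerA.
Qed.

Lemma specfun_eigen a k : specfun a *m u k = a k *: u k.
Proof.
rewrite specfun_mul (bigD1 k)//= u_ortho eqxx mulr1 big1 ?addr0// => i ik.
by rewrite u_ortho (negbTE ik) mulr0 scale0r.
Qed.

Lemma specfun_unique (A : 'M[R]_n) a :
  (forall k, A *m u k = a k *: u k) -> A = specfun a.
Proof.
move=> Au; apply: cV_ext => x; rewrite specfun_mul {1}(orthonormal_expansion x).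
rewrite mulmx_sumr; apply: eq_bigr => k _.
by rewrite -scalemxAr Au scalerA mulrC.
Qed.

Lemma specfun_adjoint a : adjoint pi pi (specfun a) (specfun a).
Proof.
move=> x y; rewrite !specfun_mul dotpi_suml dotpi_sumr; apply: eq_bigr => k _.
by rewrite dotpiZl dotpiZr (dotpiC pi x); ring.
Qed.

Lemma specfun_quadr a x :
  dotpi pi x (specfun a *m x) = \sum_k a k * dotpi pi (u k) x ^+ 2.
Proof.
rewrite specfun_mul dotpi_sumr; apply: eq_bigr => k _.
by rewrite dotpiZr (dotpiC pi x); ring.
Qed.

Lemma specfunX a m : specfun a ^+ m = specfun (fun k => a k ^+ m).
Proof.
apply: specfun_unique => k; elim: m => [|m IHm].
  by rewrite !expr0 scale1r mul1mx.
by rewrite exprS -mulmxA IHm -scalemxAr specfun_eigen scalerA exprS mulrC.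
Qed.

Lemma series_specfun a m :
  series (fun k => k`!%:R^-1 *: specfun a ^+ k) m =
  \sum_k series (exp_coeff (a k)) m *: eigenproj k.
Proof.
rewrite /series /=.
under [RHS]eq_bigr do rewrite scaler_suml.
rewrite exchange_big; apply: eq_bigr => k _ /=.
rewrite specfunX scaler_sumr; apply: eq_bigr => l _.
by rewrite scalerA /exp_coeff /= mulrC.
Qed.

Lemma expmx_specfun a : expmx (specfun a) = specfun (fun k => expR (a k)).
Proof.
apply: cvg_lim; first exact: norm_hausdorff.
rewrite (_ : series _ = fun m =>
    \sum_k series (exp_coeff (a k)) m *: eigenproj k); last first.
  by apply/funext => m; apply: series_specfun.
apply: cvg_sum_fin => k; apply: cvgZr_tmp.
exact: is_cvg_series_exp_coeff.
Qed.

(** The partial sums of the exponential series have a nonnegative entry at [(i, j)], and that entry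
    converges. *)
Lemma specfun_exp_ge0 a i j : (forall m, 0 <= (specfun a ^+ m) i j) ->
  0 <= specfun (fun k => expR (a k)) i j.
Proof.
move=> a_ge0.
have lim_ij : (\sum_k series (exp_coeff (a k)) m * eigenproj k i j @[m --> \oo]
    --> \sum_k expR (a k) * eigenproj k i j)%classic.
  apply: cvg_sum_fin => k; apply: cvgMr_tmp; exact: is_cvg_series_exp_coeff.
have -> : specfun (fun k => expR (a k)) i j =
    \sum_k expR (a k) * eigenproj k i j.
  by rewrite summxE; apply: eq_bigr => k _; rewrite mxE.
rewrite -(cvg_lim _ lim_ij)//; apply: limr_ge.
  by apply/cvg_ex; eexists; exact: lim_ij.
near=> m.
have -> : \sum_k series (exp_coeff (a k)) m * eigenproj k i j =
    (series (fun k => k`!%:R^-1 *: specfun a ^+ k) m) i j.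
  by rewrite series_specfun summxE; apply: eq_bigr => k _; rewrite [RHS]mxE.
rewrite /series /= summxE sumr_ge0// => k _; rewrite mxE mulr_ge0 ?invr_ge0 ?ler0n//.
Unshelve. all: by end_near.
Qed.

End SpectralCalculus.

Section Semigroup.
Variables (R : realType) (n : nat) (K : 'M[R]_n) (pi : 'cV[R]_n).
Variables (u : 'I_n -> 'cV[R]_n) (lam : 'I_n -> R) (t : R).
Hypothesis K_rate : rate_constant_matrix K pi.
Hypothesis u_basis : orthonormal_eigenbasis K pi u lam.
Hypothesis t_ge0 : 0 <= t.

Let pi_gt0 i : 0 < pi i 0. Proof. by case: K_rate => [[]]. Qed.
Let u_ortho i j : dotpi pi (u i) (u j) = (i == j)%:R.
Proof. by case: u_basis. Qed.

Lemma expmx_rate :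
  expmx (t *: K) = specfun pi u (fun k => expR (t * lam k)).
Proof.
rewrite -expmx_specfun//; congr expmx; apply: specfun_unique => // k.
by case: u_basis => _ _ Ku; rewrite -scalemxAl Ku scalerA.
Qed.

Lemma K_adjoint : adjoint pi pi K K.
Proof. by apply: adjoint_entries => //; case: K_rate. Qed.

Lemma K_pi : K *m pi = 0.
Proof.
case: K_rate => _ _ K_sum K_sym; apply/matrixP => i j; rewrite !mxE ord1.
by under eq_bigr do rewrite K_sym; rewrite -mulr_suml K_sum mul0r.
Qed.

(* Nonnegativity: [K + c I] has nonnegative entries for large [c], and
   [exp (t K) = exp (- t c) exp (t (K + c I))]. *)
Lemma expmx_rate_ge0 i j : 0 <= expmx (t *: K) i j.
Proof.
(* Large enough to offset every negative diagonal entry. *)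
pose c := \sum_l `|K l l|.
have Kc_ge0 k l : 0 <= (K + c%:M) k l.
  rewrite !mxE; have [->|kl] := eqVneq k l; last first.
    by rewrite addr0; case: K_rate => _ K_off _ _; apply: K_off.
  rewrite mulr1n /c (bigD1 l)//= addrA addr_ge0 ?sumr_ge0//.
  by rewrite -lerBlDl sub0r -normrN ler_norm.
have Kcm_ge0 m k l : 0 <= ((t *: (K + c%:M)) ^+ m) k l.
  elim: m k l => [|m IHm] k l; first by rewrite expr0 mxE.
  by rewrite exprS mxE sumr_ge0// => h _; rewrite mulr_ge0// mxE mulr_ge0.
have KcE : t *: (K + c%:M) = specfun pi u (fun k => t * (lam k + c)).
  apply: specfun_unique => // k; case: u_basis => _ _ Ku.
  by rewrite -scalemxAl mulmxDl Ku mul_scalar_mx -scalerDl scalerA.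
have := @specfun_exp_ge0 _ _ pi u u_ortho (fun k => t * (lam k + c)) i j.
rewrite -KcE => /(_ (fun m => Kcm_ge0 m i j)).
have -> : specfun pi u (fun k => expR (t * (lam k + c))) =
    expR (t * c) *: expmx (t *: K).
  rewrite expmx_rate; apply/esym/specfun_unique => // k.
  by rewrite -scalemxAl specfun_eigen// scalerA -expRD addrC mulrDr.
by rewrite mxE pmulr_rge0 ?expR_gt0.
Qed.

(** Total mass is [<pi, p>]; the semigroup is self-adjoint and fixes [pi], so it preserves mass. *)
Lemma expmx_rate_simplex p : simplex p -> simplex (expmx (t *: K) *m p).
Proof.
case=> p_ge0 p_sum; split=> [i|].
  by rewrite mxE sumr_ge0// => j _; rewrite mulr_ge0// expmx_rate_ge0.
rewrite -p_sum -!(dotpi_weight pi_gt0) expmx_rate -specfun_adjoint//; congr dotpi.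
rewrite specfun_mul [RHS](orthonormal_expansion u_ortho).
apply: eq_bigr => k _; congr (_ *: _).
(* Since [K pi = 0], only eigenvectors with eigenvalue 0 occur in the expansion of [pi], and there
   the exponential factor is 1. *)
have : lam k * dotpi pi (u k) pi = 0.
  case: u_basis => _ _ Ku; rewrite -dotpiZl -Ku K_adjoint K_pi.
  by rewrite -(scale0r 0) dotpiZr mul0r.
move/eqP; rewrite mulf_eq0 => /orP[]/eqP->; last by rewrite mulr0.
by rewrite mulr0 expR0 mul1r.
Qed.

End Semigroup.

(** * Block structure *)

Section Selection.
Variables (R : realType) (n : nat).
Implicit Types (I J S T : {set 'I_n}) (x : 'cV[R]_n).

Lemma sel_mulE I x i : (sel R I *m x) i 0 = x (enum_val i) 0.
Proof. by rewrite /sel mul_rowsub_mx mul1mx mxE. Qed.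

Lemma trsel_sel I i j :
  ((sel R I)^T *m sel R I) i j = ((i == j) && (i \in I))%:R.
Proof.
rewrite mxE; under eq_bigr do rewrite !mxE.
rewrite -(big_enum_val (fun k => (k == i)%:R * (k == j)%:R)).
have [iI|iI] := boolP (i \in I); last first.
  by rewrite andbF big1// => k kI; rewrite (negbTE (memPn iI k kI)) mul0r.
rewrite (bigD1 i)//= eqxx mul1r andbT big1 ?addr0// => k /andP[_ /negbTE ->].
by rewrite mul0r.
Qed.

Lemma sel_resolution S T : bipartition S T ->
  (sel R S)^T *m sel R S + (sel R T)^T *m sel R T = 1%:M.
Proof.
case=> _ _ ST0 STT; apply/matrixP => i j; rewrite mxE !trsel_sel [RHS]mxE.
have : i \in S :|: T by rewrite STT inE.
have : i \notin S :&: T by rewrite ST0 inE.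
rewrite !inE; case: (i \in S); case: (i \in T) => //= _ _.
  by rewrite andbT andbF addr0.
by rewrite andbT andbF add0r.
Qed.

Lemma sel_adjoint I (w : 'cV[R]_n) : (forall i, 0 < w i 0) ->
  adjoint (sel R I *m w) w (sel R I) (sel R I)^T.
Proof.
move=> w_gt0; apply: adjoint_entries => // [i|i j]; first by rewrite sel_mulE.
by rewrite sel_mulE !mxE; case: eqP => [->|]; rewrite ?mul0r.
Qed.

End Selection.

Section BlockStructure.
Variables (R : realType) (n : nat) (K : 'M[R]_n) (pi : 'cV[R]_n).
Variables (S T : {set 'I_n}).
Hypothesis K_rate : rate_constant_matrix K pi.
Hypothesis ST_bipart : bipartition S T.
Hypothesis KSS_unit : blk K S S \in unitmx.

Local Notation eS := (sel R S).
Local Notation eT := (sel R T).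
Local Notation KSSi := (invmx (blk K S S)).
Local Notation piS := (eS *m pi).
Local Notation piT := (eT *m pi).

Lemma pi_pos i : 0 < pi i 0. Proof. by case: K_rate => [[]]. Qed.
Lemma piS_pos i : 0 < piS i 0. Proof. by rewrite sel_mulE pi_pos. Qed.
Lemma piT_pos i : 0 < piT i 0. Proof. by rewrite sel_mulE pi_pos. Qed.

(* In block form, [lift = (- KSS^-1 KST; I)] and its adjoint
   [restr = (- KTS KSS^-1, I)], so that [restr lift = M] and
   [V = lift VTT restr]. *)
Definition lift : 'M[R]_(n, #|T|) := eT^T - eS^T *m KSSi *m blk K S T.
Definition restr : 'M[R]_(#|T|, n) := eT - blk K T S *m KSSi *m eS.

Lemma eTS : eT *m eS^T = 0.
Proof. by apply: sel_disj; case: ST_bipart => _ _; rewrite finset.setIC. Qed.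
Lemma eST : eS *m eT^T = 0.
Proof. by apply: sel_disj; case: ST_bipart. Qed.

Lemma blk_adjoint I J :
  adjoint (sel R I *m pi) (sel R J *m pi) (blk K I J) (blk K J I).
Proof.
rewrite !blkE -[sel R J *m K *m _]mulmxA.
apply: (adjointM (w2 := pi)); last exact/adjointC/sel_adjoint/pi_pos.
apply: (adjointM (w2 := pi)); first exact/sel_adjoint/pi_pos.
exact: (K_adjoint K_rate).
Qed.

Lemma KSSi_adjoint : adjoint piS piS KSSi KSSi.
Proof. exact/adjoint_inv/blk_adjoint. Qed.

Lemma lift_adjoint : adjoint pi piT lift restr.
Proof.
apply: adjointB; first exact/adjointC/sel_adjoint/pi_pos.
rewrite -[X in adjoint _ _ _ X]mulmxA.
apply: (adjointM (w2 := piS)); last exact: blk_adjoint.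
apply: (adjointM (w2 := piS)); last exact: KSSi_adjoint.
exact/adjointC/sel_adjoint/pi_pos.
Qed.

Lemma restr_lift : restr *m lift = Mmx K S T.
Proof.
rewrite /restr /lift mulmxBl !mulmxBr sel_id !mulmxA eTS !mul0mx subr0.
rewrite -!mulmxA eST !mulmx0 sub0r opprK !mulmxA.
by rewrite -(mulmxA _ eS) sel_id mulmx1 /Mmx !mulmxA.
Qed.

Lemma VmxE ty : Vmx ty K S T = lift *m VTT ty K S T *m restr.
Proof.
rewrite /Vmx /place /lift /restr !(mulmxBl, mulmxBr, mulmxN, mulNmx) !mulmxA.
rewrite opprB [RHS]addrC -!addrA; congr (_ + _).
by rewrite [RHS]addrA [RHS]addrC.
Qed.

(** Block elimination: vectors in the image of [lift] are harmonic on [S], and on [T] the matrix [K]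
    acts on them as the Schur complement. *)
Lemma K_lift : K *m lift = eT^T *m schur K S T.
Proof.
have eSK : eS *m K *m lift = 0.
  rewrite /lift mulmxBr -blkE !mulmxA -blkE (mulmxV KSS_unit) mul1mx subrr//.
have eTK : eT *m K *m lift = schur K S T.
  by rewrite /lift mulmxBr -blkE !mulmxA -blkE.
rewrite -[LHS]mul1mx -(sel_resolution R ST_bipart) mulmxDl -!mulmxA.
by rewrite (mulmxA eS K) eSK (mulmxA eT K) eTK mulmx0 add0r.
Qed.

Lemma restr_K : restr *m K = schur K S T *m eT.
Proof.
have KeS : restr *m K *m eS^T = 0.
  rewrite /restr !mulmxBl -blkE -!mulmxA (mulmxA eS) -blkE (mulVmx KSS_unit).
  by rewrite mulmx1 subrr.
have KeT : restr *m K *m eT^T = schur K S T.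
  by rewrite /restr !mulmxBl -blkE -!mulmxA (mulmxA eS) -blkE !mulmxA.
rewrite -[LHS]mulmx1 -(sel_resolution R ST_bipart) mulmxDr !mulmxA.
by rewrite KeS KeT mul0mx add0r.
Qed.

(** Solve the [S] rows of [K x], namely [KSS x_S + KST x_T], for [x_S]. *)
Lemma lift_decomposition (x : 'cV[R]_n) :
  x = lift *m (eT *m x) + eS^T *m (KSSi *m (eS *m (K *m x))).
Proof.
have eSK : eS *m K = blk K S S *m eS + blk K S T *m eT.
  by rewrite !blkE -!(mulmxA (eS *m K)) -mulmxDr (sel_resolution R ST_bipart) mulmx1.
have e : lift *m eT + eS^T *m KSSi *m (eS *m K) = 1%:M.
  rewrite eSK /lift mulmxBl mulmxDr !mulmxA (mulmxKV KSS_unit).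
  by rewrite -(sel_resolution R ST_bipart) addrCA subrK.
by rewrite -[LHS]mul1mx -e mulmxDl !mulmxA.
Qed.

Lemma schur_adjoint : adjoint piT piT (schur K S T) (schur K S T).
Proof.
apply: adjointB; first exact: blk_adjoint.
rewrite -[X in adjoint _ _ _ X]mulmxA.
apply: (adjointM (w2 := piS)); last exact: blk_adjoint.
apply: (adjointM (w2 := piS)); [exact: blk_adjoint|exact: KSSi_adjoint].
Qed.

Lemma sel_pythagoras (x : 'cV[R]_n) :
  dotpi pi x x = dotpi piS (eS *m x) (eS *m x) + dotpi piT (eT *m x) (eT *m x).
Proof.
rewrite (sel_adjoint (I := S) pi_pos) (sel_adjoint (I := T) pi_pos).
rewrite !mulmxA -dotpiDr -mulmxDl.
by rewrite (sel_resolution R ST_bipart) mul1mx.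
Qed.

Lemma dotpi_trsel (I : {set 'I_n}) (y z : 'cV[R]_#|I|) :
  dotpi pi ((sel R I)^T *m y) ((sel R I)^T *m z) = dotpi (sel R I *m pi) y z.
Proof. by rewrite -(sel_adjoint (I := I) pi_pos) mulmxA sel_id mul1mx. Qed.

Lemma dotpi_lift g h :
  dotpi pi (lift *m g) (lift *m h) = dotpi piT g (Mmx K S T *m h).
Proof. by rewrite lift_adjoint mulmxA restr_lift. Qed.

Lemma sel_lift : eT *m lift = 1%:M.
Proof. by rewrite /lift mulmxBr sel_id !mulmxA eTS !mul0mx subr0. Qed.

(** The right side is [|lift g|^2], and the [T] part of [lift g] is [g]. *)
Lemma Mmx_ge1 g : dotpi piT g g <= dotpi piT g (Mmx K S T *m g).
Proof.
rewrite -dotpi_lift sel_pythagoras (mulmxA eT) sel_lift mul1mx lerDr.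
exact/dotpi_ge0/piS_pos.
Qed.

(* Both types are treated at once: [V = lift L^-1 restr] with
   [L = diag (1^T M)] or [L = M], and only [M <= L] as quadratic forms is used. *)
Section Dominating.
Variable L : 'M[R]_#|T|.
Hypothesis L_adj : adjoint piT piT L L.
Hypothesis L_ge : forall g, dotpi piT g (Mmx K S T *m g) <= dotpi piT g (L *m g).

Let V := lift *m invmx L *m restr.

Lemma L_unit : L \in unitmx.
Proof.
apply: (posdef_unitmx piT_pos) => g; exact: le_trans (Mmx_ge1 g) (L_ge g).
Qed.

Lemma V_adj : adjoint pi pi V V.
Proof.
rewrite {2}/V -mulmxA; apply: (adjointM (w2 := piT)).
  2: exact/adjointC/lift_adjoint.
exact: (adjointM lift_adjoint (adjoint_inv L_unit L_adj)).
Qed.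

(** With [g = L^-1 y]: [|lift g|^2 = <g, M g> <= <g, L g> = <g, y> <= |g| |y| <= |lift g| |y|];
    cancel [|lift g|]. *)
Lemma lift_Linv_le y : normpi pi (lift *m (invmx L *m y)) <= normpi piT y.
Proof.
set g := invmx L *m y; have yE : y = L *m g by rewrite /g mulKVmx ?L_unit.
have gW : normpi piT g <= normpi pi (lift *m g).
  rewrite ler_sqrt; last exact/dotpi_ge0/pi_pos.
  by rewrite dotpi_lift Mmx_ge1.
have := le_trans (L_ge g) _; rewrite -dotpi_lift -yE.
move=> /(_ _ (dotpi_le_norm piT_pos g y)).
rewrite -(normpi_sqr pi_pos) expr2 => h.
have [->|W0] := eqVneq (normpi pi (lift *m g)) 0; first exact: normpi_ge0.
rewrite -(ler_pM2l (x := normpi pi (lift *m g))) ?lt_def ?W0 ?normpi_ge0//.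
by apply: (le_trans h); rewrite ler_wpM2r ?normpi_ge0.
Qed.

Lemma V_quadr_ge0 x : 0 <= dotpi pi x (V *m x).
Proof.
rewrite /V -!mulmxA dotpiC lift_adjoint; set y := restr *m x.
rewrite -[X in dotpi _ _ X](mulKVmx L_unit) -/y.
apply: (le_trans _ (L_ge _)); apply: (le_trans _ (Mmx_ge1 _)).
exact/dotpi_ge0/piT_pos.
Qed.

(** Expand [|x - V x|^2 >= 0], where [|V x|^2 = <g, M g> <= <g, L g> = <x, V x>]. *)
Lemma V_quadr_le x : dotpi pi x (V *m x) <= dotpi pi x x.
Proof.
set g := invmx L *m (restr *m x).
have e1 : dotpi pi x (V *m x) = dotpi piT g (L *m g).
  by rewrite /V -!mulmxA -/g dotpiC lift_adjoint (mulKVmx L_unit).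
have e2 : dotpi pi x (lift *m g) = dotpi pi x (V *m x) by rewrite /V -!mulmxA.
have := dotpi_ge0 pi_pos (x - lift *m g).
rewrite !dotpi_lin (dotpiC pi (lift *m g) x) e2 dotpi_lift.
by have := L_ge g; rewrite -e1; lra.
Qed.

(** [V K x = lift L^-1 D x_T], where [D] is the Schur complement, self-adjoint for [piT]. *)
Lemma VK_le x : normpi pi (V *m (K *m x)) <= rho (schur K S T) * normpi pi x.
Proof.
rewrite /V -!mulmxA (mulmxA restr) restr_K -mulmxA.
have T0 : (0 < #|T|)%N by rewrite card_gt0; case: ST_bipart.
apply: (le_trans (lift_Linv_le _)).
apply: (le_trans (normpi_le_rho piT_pos _ T0 schur_adjoint)).
rewrite ler_wpM2l//.
  have [r [_ [reig _]]] := selfadjoint_spectral piT_pos schur_adjoint.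
  exact: le_trans (normr_ge0 _) (le_rho (reig (Ordinal T0))).
rewrite ler_sqrt; last exact/dotpi_ge0/pi_pos.
rewrite sel_pythagoras lerDr; exact/dotpi_ge0/piS_pos.
Qed.

(** The defect is [lift g] with [L g = (L - M) x], and [|lift g|^2 = <g, M g> <= <g, L g> = <g, (L -
    M) x>]. *)
Lemma defect_lift_le x :
  normpi pi (lift *m x - V *m (lift *m x)) <=
  Num.sqrt (dotpi piT x (L *m x - Mmx K S T *m x)).
Proof.
set N := L *m x - Mmx K S T *m x; set g := invmx L *m N.
have -> : lift *m x - V *m (lift *m x) = lift *m g.
  rewrite /g /N /V -!mulmxA (mulmxA restr) restr_lift -mulmxBr; congr (_ *m _).
  by rewrite mulmxBr (mulKmx L_unit).
have gE : dotpi piT g (L *m g) = dotpi piT g N by rewrite (mulKVmx L_unit).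
have Mxg : dotpi piT x (Mmx K S T *m g) = dotpi piT g (Mmx K S T *m x).
  by rewrite -!dotpi_lift dotpiC.
have Lxg : dotpi piT x (L *m g) = dotpi piT g (L *m x) by rewrite -L_adj dotpiC.
rewrite ler_wsqrtr// dotpi_lift; have Mg := L_ge g; apply: (le_trans Mg).
(* Positivity of [L - M] at [x - g], together with [<g, (L - M) g> <= <g, L g>], yields
   [<g, (L - M) x> <= <x, (L - M) x>]. *)
have := L_ge (x - g); rewrite !mulmxBr !dotpi_lin Mxg Lxg gE.
move: Mg; rewrite gE /N !dotpi_lin.
have := dotpi_ge0 pi_pos (lift *m g); rewrite dotpi_lift.
by lra.
Qed.

End Dominating.

End BlockStructure.

(** * Type A: the defect [L - M] *)

Section TypeA.
Variables (R : realType) (n : nat) (K : 'M[R]_n) (pi : 'cV[R]_n).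
Variables (S T : {set 'I_n}).
Hypothesis K_rate : rate_constant_matrix K pi.
Hypothesis ST_bipart : bipartition S T.
Hypothesis KSS_unit : blk K S S \in unitmx.

Local Notation eS := (sel R S).
Local Notation eT := (sel R T).
Local Notation KSS := (blk K S S).
Local Notation KSSi := (invmx KSS).
Local Notation piS := (eS *m pi).
Local Notation piT := (eT *m pi).
Local Notation W := (lift K S T).
Local Notation sig := (sigma KSS).
Local Notation kappa := (maxnorm_off (invmx (Pimx pi) *m K)).

Let pi_gt0 := pi_pos K_rate.
Let piS_gt0 := @piS_pos _ _ _ _ S K_rate.
Let piT_gt0 := @piT_pos _ _ _ _ T K_rate.

Lemma K_offdiag i j : i != j -> 0 <= K i j.
Proof. by case: K_rate => _ + _ _; apply. Qed.

Lemma K_colsum j : \sum_i K i j = 0.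
Proof. by case: K_rate. Qed.

Lemma K_sym i j : K i j * pi j 0 = K j i * pi i 0.
Proof. by case: K_rate. Qed.

(** The square field operator of the generator [K^T] on densities, without the customary factor
    1/2. *)
Definition carre_du_champ (z : 'I_n -> R) s := \sum_j K j s * (z j - z s) ^+ 2.

Lemma carre_du_champ_ge0 z s : 0 <= carre_du_champ z s.
Proof.
apply: sumr_ge0 => j _; have [->|js] := eqVneq j s.
  by rewrite subrr expr0n mulr0.
by rewrite mulr_ge0 ?sqr_ge0// K_offdiag.
Qed.

Lemma carre_du_champE z s : carre_du_champ z s =
  \sum_j K j s * z j ^+ 2 - 2 * z s * \sum_j K j s * z j.
Proof.
have e : z s ^+ 2 * \sum_j K j s = 0 by rewrite K_colsum mulr0.
rewrite -[RHS]addr0 -[X in _ + X]e !mulr_sumr -sumrB -big_split.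
by apply: eq_bigr => j _ /=; ring.
Qed.

(** Detailed balance turns [K] into [K^T] acting on the density [x / pi]. *)
Lemma K_density (x : 'cV[R]_n) s :
  (K *m x) s 0 = pi s 0 * \sum_j K j s * (x j 0 / pi j 0).
Proof.
rewrite mxE mulr_sumr; apply: eq_bigr => j _.
rewrite mulrA (mulrC (pi s 0)) -K_sym; have pj := gt_eqF (pi_gt0 j).
by field; rewrite pj.
Qed.

(** The terms in [z_j^2] cancel by detailed balance and the zero column sums; what remains is twice
    the Dirichlet energy [- <x, K x>]. *)
Lemma K_quadr (x : 'cV[R]_n) :
  \sum_s pi s 0 * carre_du_champ (fun i => x i 0 / pi i 0) s
  = - 2 * dotpi pi x (K *m x).
Proof.
under eq_bigr => s _ do
  rewrite carre_du_champE mulrBr [pi s 0 * \sum_j _ * _ ^+ 2]mulr_sumr.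
rewrite sumrB exchange_big /= big1 => [|j _]; last first.
  under eq_bigr do rewrite mulrA (mulrC (pi _ 0)) K_sym -mulrA.
  by rewrite -mulr_suml K_colsum mul0r.
rewrite sub0r mulNr dotpiE// mulr_sumr; congr (- _); apply: eq_bigr => s _.
rewrite K_density; have ps := gt_eqF (pi_gt0 s).
by field; rewrite ps.
Qed.

Lemma K_le0 x : dotpi pi x (K *m x) <= 0.
Proof.
have : 0 <= - 2 * dotpi pi x (K *m x).
  rewrite -K_quadr sumr_ge0// => s _.
  by rewrite mulr_ge0 ?carre_du_champ_ge0// ltW.
by lra.
Qed.

Lemma KSS_le0 y : dotpi piS y (KSS *m y) <= 0.
Proof.
rewrite blkE -!mulmxA dotpiC (sel_adjoint (I := S) pi_gt0) dotpiC.
exact: K_le0.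
Qed.

Lemma S_gt0 : (0 < #|S|)%N.
Proof. by rewrite card_gt0; case: ST_bipart. Qed.

Lemma sigma_pos : 0 < sig.
Proof. exact: sigma_gt0 S_gt0 KSS_unit. Qed.

Lemma sigma_rayleigh y : sig * dotpi piS y y <= - dotpi piS y (KSS *m y).
Proof. by apply: sigma_le_quadr => //; [apply: blk_adjoint|exact: KSS_le0]. Qed.

Lemma KSSi_norm y : normpi piS (KSSi *m y) <= normpi piS y / sig.
Proof.
have s0 := sigma_pos.
rewrite normpi_le_sqr ?divr_ge0 ?normpi_ge0 ?(ltW s0)// expr_div_n normpi_sqr//.
rewrite ler_pdivlMr ?exprn_gt0//; set x := KSSi *m y.
have yE : KSS *m x = y by rewrite mulKVmx.
have h := sigma_rayleigh x; rewrite yE in h.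
(* With [sig |x|^2 <= - <x, y>], this square gives [sig^2 |x|^2 <= |y|^2]. *)
have := dotpi_ge0 piS_gt0 (y + sig *: x).
rewrite !dotpi_lin (dotpiC piS y x).
by move: h s0; move: (dotpi _ x x) (dotpi _ x y) (dotpi _ y y) => a b c; nra.
Qed.

(* [phi s / piS s] is the mean hitting time of [T] from [s]. *)
Let phi := - (KSSi *m piS).

Lemma KSS_phi : KSS *m phi = - piS.
Proof. by rewrite /phi mulmxN mulKVmx. Qed.

Lemma KSS_piS : KSS *m piS = - (blk K S T *m piT).
Proof.
apply/eqP; rewrite -addr_eq0 !blkE -!mulmxA -!mulmxDr.
rewrite (mulmxA eS^T) (mulmxA eT^T) -mulmxDl (sel_resolution R ST_bipart).
by rewrite mul1mx (K_pi K_rate) mulmx0.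
Qed.

Lemma KST_piT_ge0 s : 0 <= (blk K S T *m piT) s 0.
Proof.
rewrite mxE sumr_ge0// => j _; rewrite mulr_ge0 ?(ltW (piT_gt0 _))// mxE.
apply: K_offdiag; apply/eqP => e; case: ST_bipart => _ _ ST0 _.
have : enum_val s \in S :&: T by rewrite inE enum_valP e enum_valP.
by rewrite ST0 inE.
Qed.

(** Minimum principle for [f = phi / piS]: at a minimizer [s0] with [f s0 < 0], nonnegative
    off-diagonal rates give [(KSS phi)_s0 >= f s0 (KSS piS)_s0 >= 0], contradicting
    [KSS phi = - piS]. *)
Lemma phi_ge0 s : 0 <= phi s 0.
Proof.
pose f s := phi s 0 / piS s 0.
have [s0 _ /= s0min] := @arg_minP _ _ _ (Ordinal S_gt0) xpredT f isT.
have phiE k : phi k 0 = piS k 0 * f k.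
  by rewrite /f mulrC divfK// gt_eqF.
suff fs0 : 0 <= f s0.
  by rewrite phiE mulr_ge0 ?(ltW (piS_gt0 _))// (le_trans fs0)// s0min.
rewrite leNgt; apply/negP => fs0_lt0.
have : (KSS *m phi) s0 0 >= f s0 * (KSS *m piS) s0 0.
  have mulE v : (KSS *m v) s0 0 = \sum_k KSS s0 k * v k 0 by rewrite mxE.
  rewrite !mulE mulr_sumr ler_sum// => k _; rewrite phiE mulrCA [f s0 * _]mulrC.
  have [->//|ks0] := eqVneq k s0.
  rewrite ler_wpM2l//; last by rewrite ler_wpM2l ?(ltW (piS_gt0 _))// s0min.
  by rewrite mxE K_offdiag// (inj_eq enum_val_inj) eq_sym.
have mxN (v : 'cV[R]_#|S|) : (- v) s0 0 = - v s0 0 by rewrite mxE.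
rewrite KSS_phi KSS_piS !mxN; have := KST_piT_ge0 s0; have := piS_gt0 s0.
by nra.
Qed.

Lemma K_le_kappa i j : i != j -> K i j <= kappa * pi i 0.
Proof.
move=> ij; rewrite -ler_pdivrMr//.
have -> : K i j / pi i 0 = (invmx (Pimx pi) *m K) i j.
  by rewrite invmx_Pimx// mul_diag_mx !mxE mulrC.
apply: (le_trans (ler_norm _)).
exact: (le_bigmax_cond _ (fun ij : 'I_n * 'I_n => `|_ ij.1 ij.2|)
  (j := (i, j)) ij).
Qed.

Lemma kappa_ge0 : 0 <= kappa.
Proof. exact: bigmax_ge_id. Qed.

Lemma sum_piS_piT : \sum_s piS s 0 + \sum_j piT j 0 = 1.
Proof.
rewrite -(dotpi_weight piS_gt0) -(dotpi_weight piT_gt0).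
by rewrite -(sel_pythagoras K_rate ST_bipart) dotpi_weight//; case: K_rate => [[]].
Qed.

Lemma sum_piS_gt0 : 0 < \sum_s piS s 0.
Proof.
rewrite (bigD1 (Ordinal S_gt0))//= ltr_pwDl// sumr_ge0// => s _.
exact: ltW.
Qed.

(** The Rayleigh bound at [piS] compares [sig] with the stationary flow between [S] and [T], each of
    whose rates is at most [kappa pi_s]. *)
Lemma sigma_le_kappa : sig <= kappa * \sum_j piT j 0.
Proof.
have := sigma_rayleigh piS.
rewrite KSS_piS dotpiNr opprK !(dotpi_weight piS_gt0) => h.
rewrite -(ler_pM2r sum_piS_gt0); apply: (le_trans h).
rewrite mulrAC [kappa * _]mulr_sumr mulr_suml; apply: ler_sum => s _.
rewrite [leLHS]mxE mulr_sumr; apply: ler_sum => j _.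
rewrite ler_wpM2r ?(ltW (piT_gt0 _))// sel_mulE mxE K_le_kappa//.
apply/eqP => e; case: ST_bipart => _ _ ST0 _.
have : enum_val s \in S :&: T by rewrite inE enum_valP e enum_valP.
by rewrite ST0 inE.
Qed.

(** Combine [sig |phi|^2 <= <phi, piS>] with [|piS - sig phi|^2 >= 0]; pairing with [piS] is
    summation of coordinates. *)
Lemma sum_phi_le : sig * \sum_s phi s 0 <= \sum_s piS s 0.
Proof.
have := sigma_rayleigh phi; rewrite KSS_phi.
move: (phi) => v; rewrite dotpiNr opprK.
have := dotpi_ge0 piS_gt0 (piS - sig *: v).
rewrite !dotpi_lin (dotpiC piS v piS) !(dotpi_weight piS_gt0).
by have := sigma_pos; move: (dotpi _ v v) => a; nra.
Qed.

(** Row [s] of [KSS phi = - piS] with [sig <= - KSS s s] gives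
    [sig phi_s <= pi_s (1 + kappa sum phi)]. After multiplication by [sig], the two terms are at
    most [kappa pi_s] times the masses of [T] and [S], which add up to 1. *)
Lemma phi_le s : phi s 0 <= kappa / sig ^+ 2 * piS s 0.
Proof.
have sig0 := sigma_pos.
rewrite mulrAC ler_pdivlMr ?exprn_gt0//.
have sig_diag : sig <= - KSS s s.
  have := sigma_rayleigh (delta_mx s 0).
  have dE v : dotpi piS (delta_mx s 0) v = v s 0 / piS s 0.
    rewrite dotpiE// (bigD1 s)//= big1 ?addr0 => [|k /negbTE ks].
      by rewrite mxE !eqxx mul1r.
    by rewrite mxE ks !mul0r.
  have d1 : (delta_mx s 0 : 'cV[R]_#|S|) s 0 = 1 by rewrite mxE !eqxx.
  have colE' : col s KSS s 0 = KSS s s by rewrite [LHS]mxE.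
  by rewrite !dE -colE d1 colE' mulrA -mulNr ler_pM2r ?invr_gt0// mulr1.
have row_s : - KSS s s * phi s 0 =
    piS s 0 + \sum_(k | k != s) KSS s k * phi k 0.
  have : (KSS *m phi) s 0 = - piS s 0 by rewrite KSS_phi mxE.
  have -> : (KSS *m phi) s 0 = \sum_k KSS s k * phi k 0 by rewrite mxE.
  rewrite (bigD1 s)//= mulNr. move: (KSS s s * phi s 0) (\sum_(k | _) _) => a b; lra.
have sum_s : \sum_(k | k != s) KSS s k * phi k 0 <=
    kappa * piS s 0 * \sum_k phi k 0.
  rewrite mulr_sumr [leRHS](bigD1 s)//=.
  rewrite -[leLHS]add0r lerD//.
    by rewrite !mulr_ge0 ?phi_ge0 ?kappa_ge0 ?(ltW (piS_gt0 _)).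
  apply: ler_sum => k ks; rewrite ler_wpM2r ?phi_ge0//.
  by rewrite sel_mulE mxE K_le_kappa// (inj_eq enum_val_inj) eq_sym.
have := sum_phi_le; have := sum_piS_piT; have := sigma_le_kappa.
have := phi_ge0 s; have := piS_gt0 s; have := kappa_ge0.
move: row_s sum_s sig_diag sig0.
move: (- KSS s s) (phi s 0) (piS s 0) kappa sig => d f p kap sg.
set rest := \sum_(k | _) _; set F := \sum_k _.
set PT := \sum_j _; set PS := \sum_j _.
move: rest F PS PT => rest F PS PT row_s rest_le sd sig0 k0 p0 f0 sig_le PST F_le.
have kp : 0 <= kap * p by rewrite mulr_ge0 ?(ltW p0).
have h1 : sg * rest <= kap * p * PS.
  have := ler_wpM2l (ltW sig0) rest_le; have := ler_wpM2l kp F_le; lra.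
have h2 : sg * (sg * f) <= sg * (d * f).
  by rewrite ler_wpM2l ?(ltW sig0)// ler_wpM2r.
rewrite row_s in h2.
have h3 : sg * p <= kap * PT * p by rewrite ler_wpM2r ?(ltW p0).
have -> : kap * p = kap * p * (PS + PT) by rewrite PST mulr1.
by lra.
Qed.

Let LA : 'M[R]_#|T| := diag_mx (const_mx 1 *m Mmx K S T).

Lemma lift_piT : W *m piT = pi.
Proof.
rewrite [RHS](lift_decomposition ST_bipart KSS_unit pi) (K_pi K_rate).
by rewrite !mulmx0 addr0.
Qed.

(** Column sums of the self-adjoint [M] become entries of [M piT], and
    [M piT = restr (lift piT) = restr pi]. *)
Lemma LA_piT j : LA j j * piT j 0 = (restr K S T *m pi) j 0.
Proof.
have M_adj : adjoint piT piT (Mmx K S T) (Mmx K S T).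
  rewrite -(restr_lift _ ST_bipart).
  by apply: (adjointM (w2 := pi)); [apply: adjointC|]; apply: lift_adjoint.
have -> : LA j j = \sum_i Mmx K S T i j.
  rewrite [LHS]mxE eqxx mulr1n mxE; apply: eq_bigr => i _.
  by rewrite [const_mx _ _ _]mxE mul1r.
rewrite -[in RHS]lift_piT mulmxA restr_lift// [RHS]mxE mulr_suml.
by apply: eq_bigr => i _; apply: adjoint_entriesV.
Qed.

(** [phi] is chosen so that [K phi] cancels [pi] on [S]; the diagonal of [LA] is what is left on
    [T], up to the weight [piT]. *)
Lemma pi_K_phi : pi + K *m (eS^T *m phi) = eT^T *m (restr K S T *m pi).
Proof.
have eS0 : eS *m (pi + K *m (eS^T *m phi)) = 0.
  by rewrite mulmxDr !mulmxA -blkE KSS_phi subrr.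
have eT0 : eT *m (pi + K *m (eS^T *m phi)) = restr K S T *m pi.
  by rewrite mulmxDr /restr mulmxBl !mulmxA -blkE mulmxN !mulmxA.
rewrite -[LHS]mul1mx -(sel_resolution R ST_bipart) mulmxDl -!mulmxA eS0 eT0.
by rewrite mulmx0 add0r.
Qed.

(** With [b = pi z^2], the left side is [<pi + K phi, b>]. The [pi] term is [|W x|^2 = <x, M x>]; in
    the other, [K] is moved onto [b]. *)
Lemma LA_quadr x :
  dotpi piT x (LA *m x) = dotpi piT x (Mmx K S T *m x) +
    \sum_s phi s 0 *
      carre_du_champ (fun i => (W *m x) i 0 / pi i 0) (enum_val s).
Proof.
pose z i := (W *m x) i 0 / pi i 0.
pose b := \col_i (pi i 0 * z i ^+ 2).
have -> : dotpi piT x (LA *m x) = dotpi piT (restr K S T *m pi) (eT *m b).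
  rewrite !dotpiE//; apply: eq_bigr => j _; rewrite -LA_piT.
  have zj : z (enum_val j) = x j 0 / piT j 0.
    by rewrite /z -!sel_mulE mulmxA sel_lift// mul1mx.
  have -> : (LA *m x) j 0 = LA j j * x j 0.
    rewrite /LA mul_diag_mx mxE; congr (_ * _).
    by rewrite [RHS]mxE eqxx mulr1n.
  have -> : (eT *m b) j 0 = piT j 0 * (x j 0 / piT j 0) ^+ 2.
    by rewrite sel_mulE mxE zj -sel_mulE.
  have pj := gt_eqF (piT_gt0 j); by field; rewrite pj.
rewrite dotpiC (sel_adjoint (I := T) pi_gt0) -pi_K_phi dotpiC dotpiDl.
congr (_ + _).
  rewrite -dotpi_lift// dotpi_weight// dotpiE//; apply: eq_bigr => i _.
  by rewrite mxE /z; have pj := gt_eqF (pi_gt0 i); field; rewrite pj.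
rewrite (K_adjoint K_rate) (adjointC (sel_adjoint (I := S) pi_gt0)) dotpiE//.
apply: eq_bigr => s _; rewrite -mulrA; congr (_ * _).
rewrite !sel_mulE K_density carre_du_champE.
(* Harmonicity on [S] removes the cross term of the expanded square. *)
have KWx : (K *m (W *m x)) (enum_val s) 0 = 0.
  rewrite -sel_mulE (mulmxA K) K_lift// -mulmxA (mulmxA eS) eST// mul0mx.
  exact: mxE.

have /eqP := KWx; rewrite K_density mulf_eq0 (gt_eqF (pi_gt0 _)) /= => /eqP ->.
rewrite mulr0 subr0 mulrAC mulfV ?mul1r ?gt_eqF//.
apply: eq_bigr => j _; congr (_ * _).
by rewrite mxE mulrAC mulfV ?mul1r ?gt_eqF.
Qed.

Lemma LA_adjoint : adjoint piT piT LA LA.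
Proof.
exact: adjoint_diag.
Qed.

Lemma LA_ge x : dotpi piT x (Mmx K S T *m x) <= dotpi piT x (LA *m x).
Proof.
rewrite LA_quadr lerDl sumr_ge0// => s _.
by rewrite mulr_ge0 ?phi_ge0 ?carre_du_champ_ge0.
Qed.

(* The harmonic extension [W (eT y)] of the restriction of [y] to [T]
   minimizes the Dirichlet energy. *)
Lemma energy_lift_le y :
  dotpi pi y (K *m y) <= dotpi pi (W *m (eT *m y)) (K *m (W *m (eT *m y))).
Proof.
set v := W *m (eT *m y); pose w := KSSi *m (eS *m (K *m y)).
have yE : y = v + eS^T *m w := lift_decomposition ST_bipart KSS_unit y.
have w0 : dotpi pi (eS^T *m w) (K *m v) = 0.
  rewrite (adjointC (sel_adjoint (I := S) pi_gt0)) /v (mulmxA K) K_lift//.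
  by rewrite -mulmxA (mulmxA eS) eST// mul0mx -(scale0r 0) dotpiZr mul0r.
have w0' : dotpi pi v (K *m (eS^T *m w)) = 0.
  by rewrite -(K_adjoint K_rate) dotpiC.
rewrite [in leLHS]yE mulmxDr !dotpi_lin w0 w0' add0r addr0.
by rewrite gerDl K_le0.
Qed.

(** The pointwise bound on [phi] and nonnegativity allow the sum over [S] to be extended to all
    states, giving the energy of the harmonic extension, which is at most that of [y]. *)
Lemma LA_defect_le y :
  dotpi piT (eT *m y) (LA *m (eT *m y) - Mmx K S T *m (eT *m y)) <=
  2 * kappa * - dotpi pi y (K *m y) / sig ^+ 2.
Proof.
set x := eT *m y; rewrite dotpiDr dotpiNr LA_quadr addrAC subrr add0r.
pose z i := (W *m x) i 0 / pi i 0.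
have c0 : 0 <= kappa / sig ^+ 2 by rewrite divr_ge0 ?kappa_ge0 ?sqr_ge0.
apply: (@le_trans _ _ (kappa / sig ^+ 2 *
    \sum_s pi s 0 * carre_du_champ z s)).
  apply: (@le_trans _ _ (\sum_(s < #|S|) kappa / sig ^+ 2 *
      (pi (enum_val s) 0 * carre_du_champ z (enum_val s)))).
    apply: ler_sum => s _; rewrite mulrA -sel_mulE.
    by rewrite ler_wpM2r ?carre_du_champ_ge0// phi_le.
  rewrite -mulr_sumr ler_wpM2l//.
  rewrite -(big_enum_val (fun s => pi s 0 * carre_du_champ z s)).
  rewrite [leRHS](bigID (mem S))/= lerDl sumr_ge0// => s _.
  by rewrite mulr_ge0 ?carre_du_champ_ge0// ltW.
rewrite K_quadr; have := energy_lift_le y; rewrite -/x => h.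
have := ler_wpM2l c0 h.
by move: (dotpi pi _ _) (dotpi pi _ _) => a b; lra.
Qed.

End TypeA.

(** * Bounds on [V - exp (t K)] *)

Section ErrorOperator.
Variables (R : realType) (n : nat) (K : 'M[R]_n) (pi : 'cV[R]_n).
Variables (u : 'I_n -> 'cV[R]_n) (lam : 'I_n -> R) (S T : {set 'I_n}).
Variables (ty : vtype) (t : R).
Hypothesis K_rate : rate_constant_matrix K pi.
Hypothesis u_basis : orthonormal_eigenbasis K pi u lam.
Hypothesis ST_bipart : bipartition S T.
Hypothesis KSS_unit : blk K S S \in unitmx.
Hypothesis t_ge0 : 0 <= t.

Local Notation piS := (sel R S *m pi).
Local Notation piT := (sel R T *m pi).
Local Notation sig := (sigma (blk K S S)).
Local Notation kappa := (maxnorm_off (invmx (Pimx pi) *m K)).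

Let pi_gt0 := pi_pos K_rate.
Let piS_gt0 := @piS_pos _ _ _ _ S K_rate.
Let u_ortho i j : dotpi pi (u i) (u j) = (i == j)%:R.
Proof. by case: u_basis. Qed.
Let Ku k : K *m u k = lam k *: u k. Proof. by case: u_basis. Qed.

Lemma normpi_eigen k : normpi pi (u k) = 1.
Proof. by rewrite /normpi u_ortho eqxx sqrtr1. Qed.

Lemma lam_le0 k : lam k <= 0.
Proof.
by have := K_le0 K_rate (u k); rewrite Ku dotpiZr u_ortho eqxx mulr1.
Qed.

Let L : 'M[R]_#|T| :=
  if ty is TypeA then diag_mx (const_mx 1 *m Mmx K S T) else Mmx K S T.

Lemma Vmx_L : Vmx ty K S T = lift K S T *m invmx L *m restr K S T.
Proof. by rewrite VmxE /L; case: ty. Qed.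

Let L_adj : adjoint piT piT L L.
Proof.
rewrite /L; case: ty; first exact: LA_adjoint.
rewrite -(restr_lift _ ST_bipart).
by apply: (adjointM (w2 := pi)); [apply: adjointC|]; apply: lift_adjoint.
Qed.

Let L_ge g : dotpi piT g (Mmx K S T *m g) <= dotpi piT g (L *m g).
Proof. by rewrite /L; case: ty => //; exact: LA_ge. Qed.

Let V := Vmx ty K S T.

Lemma Vmx_adjoint : adjoint pi pi V V.
Proof. by rewrite /V Vmx_L; apply: V_adj. Qed.

Lemma Vmx_quadr x : 0 <= dotpi pi x (V *m x) <= dotpi pi x x.
Proof. by rewrite /V Vmx_L V_quadr_ge0// V_quadr_le. Qed.

Lemma sub1V_contraction x : normpi pi (x - V *m x) <= normpi pi x.
Proof.
have -> : x - V *m x = (1%:M - V) *m x by rewrite mulmxBl mul1mx.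
apply: (selfadjoint_contraction pi_gt0).
  exact: adjointB (@adjoint1 _ _ pi) Vmx_adjoint.
move=> y; rewrite mulmxBl mul1mx dotpiDr dotpiNr.
by have := Vmx_quadr y; rewrite ler_norml; lra.
Qed.

(** Split [u k] into its harmonic part and a part supported on [S], and use that [I - V] is a
    contraction on the latter. The term [1 - expR (t * lam k)] is the norm of [(I - E) u k]. *)
Lemma Vmx_defect k :
  normpi pi (u k - V *m u k) + 1 - expR (t * lam k) <=
  beta ty K pi S t (lam k).
Proof.
have s0 := sigma_pos ST_bipart KSS_unit.
set x := u k.
pose w := (sel R S)^T *m (invmx (blk K S S) *m (sel R S *m (K *m x))).
pose v := lift K S T *m (sel R T *m x).
have xE : x = v + w := lift_decomposition ST_bipart KSS_unit x.
have w_le : normpi pi w <= `|lam k| / sig.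
  rewrite /w {1}/normpi (dotpi_trsel K_rate).
  apply: (le_trans (KSSi_norm K_rate ST_bipart KSS_unit _)).
  rewrite ler_pM2r ?invr_gt0// Ku -scalemxAr normpiZ.
  rewrite ler_piMr ?normr_ge0// -(normpi_eigen k) normpi_le_sqr ?normpi_ge0//.
  rewrite normpi_sqr// (sel_pythagoras K_rate ST_bipart) lerDl.
  exact/dotpi_ge0/(@piT_pos _ _ _ _ T K_rate).
have v_le : normpi pi (v - V *m v) <= Num.sqrt
    (dotpi piT (sel R T *m x) (L *m (sel R T *m x) - Mmx K S T *m (sel R T *m x))).
  by rewrite /V Vmx_L; apply: defect_lift_le.
have xV : normpi pi (x - V *m x) <= normpi pi (v - V *m v) + normpi pi w.
  rewrite xE mulmxDr opprD addrACA.
  apply: (le_trans (ler_normpiD pi_gt0 _ _)); rewrite lerD2l.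
  exact: sub1V_contraction.
have l_abs : - dotpi pi x (K *m x) = `|lam k|.
  by rewrite Ku dotpiZr u_ortho eqxx mulr1 ler0_norm ?lam_le0.
move: v_le xV; rewrite /beta /L; case: ty => v_le xV; rewrite lerD2r lerD2r.
  apply: (le_trans xV); rewrite addrC mulrDl lerD//; apply: (le_trans v_le).
  have -> : Num.sqrt (2 * kappa * `|lam k|) / sig =
      Num.sqrt (2 * kappa * `|lam k| / sig ^+ 2).
    rewrite [RHS]sqrtrM ?mulr_ge0 ?kappa_ge0 ?ler0n//.
    rewrite sqrtrV ?sqr_ge0// sqrtr_sqr.
    by rewrite (gtr0_norm s0).
  by rewrite ler_wsqrtr// -l_abs; apply: LA_defect_le.
apply: (le_trans xV); rewrite -[leRHS]add0r lerD//; apply: (le_trans v_le).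
by rewrite subrr -(scale0r 0) dotpiZr mul0r sqrtr0.
Qed.

Let E := specfun pi u (fun k => expR (t * lam k)).
Let X := V - E.

Lemma err_adjoint : adjoint pi pi X X.
Proof. by apply: adjointB; [exact: Vmx_adjoint|exact: specfun_adjoint]. Qed.

Lemma expR_le1_eigen k : expR (t * lam k) <= 1.
Proof. by rewrite expR_le1 mulr_ge0_le0 ?lam_le0. Qed.

(** Both [V] and [E] lie between 0 and the identity as forms, so the form of their difference is at
    most [|x|^2] in absolute value. *)
Lemma err_contraction x : normpi pi (X *m x) <= normpi pi x.
Proof.
apply: (selfadjoint_contraction pi_gt0 err_adjoint) => y.
have E_bounds : 0 <= dotpi pi y (E *m y) <= dotpi pi y y.
  rewrite specfun_quadr sumr_ge0 => [|k _]; last first.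
    by rewrite mulr_ge0 ?expR_ge0 ?sqr_ge0.
  rewrite (parseval u_ortho); apply: ler_sum => k _.
  by rewrite -expr2 ler_piMl ?sqr_ge0 ?expR_le1_eigen.
rewrite mulmxBl dotpiDr dotpiNr ler_norml.
by have := Vmx_quadr y; lra.
Qed.

Lemma le_min1ab (c l : R) : c <= 1 ->
  (l != 0 -> c <= rho (schur K S T) / `|l| + expR (t * l)) ->
  c <= beta ty K pi S t l -> c <= min1ab ty K pi S T t l.
Proof.
move=> c1 ca cb; rewrite /min1ab /alpha; have [l0|l0] := eqVneq l 0.
  by rewrite minye -EFin_min /= le_min c1 cb.
by rewrite -!EFin_min /= !le_min c1 cb ca.
Qed.

Lemma err_eigen k : normpi pi (X *m u k) <= min1ab ty K pi S T t (lam k).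
Proof.
have Eu : E *m u k = expR (t * lam k) *: u k by apply: specfun_eigen.
apply: le_min1ab.
- by rewrite (le_trans (err_contraction _))// normpi_eigen.
- move=> l0; rewrite mulmxBl (le_trans (ler_normpiD pi_gt0 _ _))//.
  rewrite normpiN// Eu normpiZ normpi_eigen mulr1 ger0_norm ?expR_ge0// lerD2r.
  (* Introducing [K] brings in the Schur complement bound on [V K]. *)
  have -> : V *m u k = (lam k)^-1 *: (V *m (K *m u k)).
    by rewrite Ku -scalemxAr scalerA mulVf// scale1r.
  rewrite normpiZ normfV mulrC ler_pM2r ?invr_gt0 ?normr_gt0//.
  by rewrite -[leRHS]mulr1 -(normpi_eigen k) /V Vmx_L VK_le.
- apply: le_trans (Vmx_defect k); rewrite mulmxBl Eu -normpiN opprB.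
  have -> : expR (t * lam k) *: u k - V *m u k =
      (u k - V *m u k) + (expR (t * lam k) - 1) *: u k.
    by rewrite scalerBl scale1r [RHS]addrC addrA subrK.
  apply: (le_trans (ler_normpiD pi_gt0 _ _)).
  rewrite normpiZ normpi_eigen mulr1 ler0_norm ?subr_le0 ?expR_le1_eigen//.
  by rewrite opprB addrA.
Qed.

Lemma Err_le p : simplex p ->
  Err ty K pi S T t p <= normpi pi (X *m p) / normpi pi p.
Proof.
move=> p_simplex; rewrite /Err ler_wpM2r ?invr_ge0 ?normpi_ge0//.
have pi_simplex : open_simplex pi by case: K_rate.
have Ep := expmx_rate_simplex K_rate u_basis t_ge0 p_simplex.
apply: (le_trans (proj_le pi_simplex _ Ep)).
by rewrite (expmx_rate t u_basis) /X mulmxBl.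
Qed.

Lemma err_expansion p :
  normpi pi (X *m p) <= \sum_k `|dotpi pi (u k) p| * normpi pi (X *m u k).
Proof.
rewrite {1}(orthonormal_expansion u_ortho p) mulmx_sumr.
apply: (le_trans (ler_normpi_sum pi_gt0 _ _ _)); apply: ler_sum => k _.
by rewrite -scalemxAr normpiZ.
Qed.

(* The Hilbert-Schmidt norm of [X], computed in two orthonormal bases. *)
Lemma err_hilbert_schmidt :
  \sum_i pi i 0 * dotpi pi (X *m delta_mx i 0) (X *m delta_mx i 0) =
  \sum_k dotpi pi (X *m u k) (X *m u k).
Proof.
under eq_bigr do rewrite (parseval u_ortho) mulr_sumr.
rewrite exchange_big; apply: eq_bigr => k _ /=.
rewrite [RHS]dotpiE//; apply: eq_bigr => i _.
have -> : dotpi pi (u k) (X *m delta_mx i 0) = (X *m u k) i 0 / pi i 0.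
  rewrite -err_adjoint dotpiE// (bigD1 i)//= big1 ?addr0 => [|j /negbTE ji].
    by rewrite [delta_mx _ _ _ _]mxE !eqxx mulr1.
  by rewrite [delta_mx _ _ _ _]mxE ji mulr0 mul0r.
by have pj := gt_eqF (pi_gt0 i); field; rewrite pj.
Qed.

End ErrorOperator.

(** * Averaging over the standard basis and the final bounds *)

Lemma sqr_mean_le (R : realFieldType) n (a : 'I_n -> R) :
  (n%:R^-1 * \sum_i a i) ^+ 2 <= n%:R^-1 * \sum_i a i ^+ 2.
Proof.
have [->|n1] := eqVneq (n%:R : R) 0; first by rewrite invr0 !mul0r expr0n.
have n0 : (0 < n)%N by rewrite lt0n -(pnatr_eq0 R).
set m := n%:R^-1 * _.
have am : \sum_i a i = n%:R * m by rewrite /m mulVKf.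
(* The claim is nonnegativity of the variance. *)
have : 0 <= \sum_i (a i - m) ^+ 2 by apply: sumr_ge0 => i _; apply: sqr_ge0.
have -> : \sum_i (a i - m) ^+ 2 =
    \sum_i a i ^+ 2 - 2 * m * \sum_i a i + n%:R * m ^+ 2.
  have -> : n%:R * m ^+ 2 = \sum_(i < n) m ^+ 2.
    by rewrite sumr_const card_ord mulr_natl.
  rewrite mulr_sumr -sumrB -big_split; apply: eq_bigr => i _ /=; ring.
by rewrite am => h; rewrite ler_pdivlMl ?ltr0n//; lra.
Qed.

Lemma delta_simplex (R : realType) n (i : 'I_n) :
  simplex (delta_mx i 0 : 'cV[R]_n).
Proof.
split=> [j|]; first by rewrite mxE ler0n.
rewrite (bigD1 i)//= big1 ?addr0 => [|j /negbTE ji].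
  by rewrite mxE !eqxx.
by rewrite mxE ji.
Qed.

Theorem theorem4p6 (R : realType) (n : nat) (K : 'M[R]_n) (pi : 'cV[R]_n)
    (u : 'I_n -> 'cV[R]_n) (lam : 'I_n -> R) (S T : {set 'I_n}) (ty : vtype)
    (t : R)
    (K_rate : rate_constant_matrix K pi)
    (u_basis : orthonormal_eigenbasis K pi u lam)
    (ST_bipart : bipartition S T)
    (KSS_nonsing : blk K S S \in unitmx)
    (t_ge0 : 0 <= t) :
  (forall p : 'cV[R]_n, simplex p ->
     Err ty K pi S T t p <=
       Num.min
         (\sum_(k < n) `|dotpi pi (u k) p| / normpi pi p
                       * min1ab ty K pi S T t (lam k))
         1)
  /\
  expectation_basis (fun p => Err ty K pi S T t p) <=
    Num.min
      (Num.sqrt (n%:R^-1 * \sum_(k < n) min1ab ty K pi S T t (lam k) ^+ 2))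
      1.
Proof.
have pi_gt0 := pi_pos K_rate.
pose X := Vmx ty K S T - specfun pi u (fun k => expR (t * lam k)).
have Err_X p : simplex p ->
    Err ty K pi S T t p <= normpi pi (X *m p) / normpi pi p.
  exact: Err_le.
have X_u k : normpi pi (X *m u k) <= min1ab ty K pi S T t (lam k).
  exact: err_eigen.
have Err_le1 p : simplex p -> Err ty K pi S T t p <= 1.
  move=> p_simplex; apply: (le_trans (Err_X p p_simplex)).
  (* For norm zero the quotient is 0 by the convention on inverses. *)
  have [->|p0] := eqVneq (normpi pi p) 0; first by rewrite invr0 mulr0.
  rewrite ler_pdivrMr ?lt_def ?p0 ?normpi_ge0// mul1r.
  exact: err_contraction.
have n_gt0 : (0 < n)%N.
  case: ST_bipart => /set0Pn[i _] _ _ _; exact: leq_ltn_trans (ltn_ord i).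
split=> [p p_simplex|].
  rewrite le_min Err_le1// andbT; apply: (le_trans (Err_X p p_simplex)).
  under eq_bigr do rewrite mulrAC.
  rewrite -mulr_suml ler_wpM2r ?invr_ge0 ?normpi_ge0//.
  apply: (le_trans (err_expansion _ _ _ _ K_rate u_basis _)).
  by apply: ler_sum => k _; rewrite ler_wpM2l ?normr_ge0.
rewrite /expectation_basis le_min; apply/andP; split; last first.
  rewrite mulrC ler_pdivrMr ?ltr0n// mul1r.
  apply: (@le_trans _ _ (\sum_(i < n) 1)).
    by apply: ler_sum => i _; apply/Err_le1/delta_simplex.
  by rewrite sumr_const card_ord.
apply: (le_trans (ler_norm _)); rewrite -sqrtr_sqr ler_wsqrtr//.
apply: (le_trans (sqr_mean_le _)); rewrite ler_wpM2l ?invr_ge0 ?ler0n//.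
(* The squared Hilbert-Schmidt norm is the middle term: the basis [u] bounds it above, the standard
   basis below. *)
apply: (@le_trans _ _ (\sum_k dotpi pi (X *m u k) (X *m u k))); last first.
  apply: ler_sum => k _; rewrite -normpi_sqr//.
  by rewrite ler_pXn2r ?nnegrE ?normpi_ge0// (le_trans _ (X_u k)) ?normpi_ge0.
rewrite -(err_hilbert_schmidt _ _ K_rate u_basis)//.
apply: ler_sum => i _.
(* Dividing by this squared norm produces exactly the weight [pi_i] of the Hilbert-Schmidt sum. *)
have d_norm : normpi pi (delta_mx i 0) ^+ 2 = (pi i 0)^-1.
  rewrite normpi_sqr// dotpiE// (bigD1 i)//= big1 ?addr0 => [|j /negbTE ji].
    by rewrite mxE !eqxx mulr1 mul1r.
  by rewrite mxE ji !mul0r.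
have := Err_X _ (delta_simplex R i) => h.
have Err_ge0 : 0 <= Err ty K pi S T t (delta_mx i 0).
  by rewrite divr_ge0 ?normpi_ge0.
apply: (@le_trans _ _
  ((normpi pi (X *m delta_mx i 0) / normpi pi (delta_mx i 0)) ^+ 2)).
  by rewrite ler_pXn2r ?nnegrE// (le_trans Err_ge0).
by rewrite expr_div_n d_norm invrK normpi_sqr// mulrC.
Qed.
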